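(* Consider full-batch Noisy-SGD ($\mathcal{B}_t=[n]$, $b=n$) run for $T\ge1$ iterations, and assume that for every $d\in\mathcal{X}$ the gradient $\nabla\ell(\cdot;d)$ is $(L,\lambda)$-Hölder continuous on $\mathcal{K}$ with $L\ge0$, $\lambda\in(0,1]$. Let $g(x)=x+\eta Lx^\lambda$ on $\mathbb{R}_{\ge0}$ and $h=g^{-1}:\mathbb{R}_{\ge0}\to\mathbb{R}_{\ge0}$. Then for every $\alpha>1$, $W_T$ is $(\alpha,\varepsilon(\alpha))$-RDP with $$\varepsilon(\alpha)\le\min_{\tau,\beta,a}\ \frac{\alpha}{2\sigma^2}\sum_{t=\tau}^{T-1}\left(\frac{1}{\beta_t}\Big(\frac{2\eta K}{n}\Big)^2+\frac{a_t^2}{1-\beta_t}\right),$$ where the minimum is over $\tau\in\{0,\dots,T-1\}$, $\beta_t\in[0,1]$ and $a_t\ge0$ for $t\ge\tau$, subject to $A_\tau\ge D_\tau$, where $A_T=0$, $A_{t-1}=h(A_t+a_{t-1})$ for $t=T,T-1,\dots,\tau+1$, and $D_0=0$, $D_t=\min\big(g(D_{t-1})+2\eta K/n,\ D_{t-1}+2\eta K,\ D\big)$ for $t\ge1$.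
   Context: Setting (Noisy-SGD). Let $\mathcal{K}\subset\mathbb{R}^d$ be a nonempty closed convex set of diameter $D$, and $\Pi_{\mathcal{K}}$ the Euclidean projection onto $\mathcal{K}$. Let $\mathcal{X}$ be a data domain and $\ell(\cdot;d)$, $d\in\mathcal{X}$, differentiable loss functions on $\mathcal{K}$. For a dataset $\mathcal{D}=(d_1,\dots,d_n)\in\mathcal{X}^n$ write $\ell_i=\ell(\cdot;d_i)$. For $K>0$, $\Pi_{B_K}(v)=v\min(1,K/\|v\|)$ is the projection onto the closed Euclidean ball of radius $K$. Given step size $\eta>0$, noise level $\sigma>0$, batch size $b$, index sets $\mathcal{B}_t\subseteq[n]$ with $|\mathcal{B}_t|=b$, and $W_0\in\mathcal{K}$, Noisy-SGD iterates $W_{t+1}=\Pi_{\mathcal{K}}\big[W_t-\eta\frac1b\sum_{i\in\mathcal{B}_t}\Pi_{B_K}[\nabla\ell_i(W_t)]+G_t\big]$, with $G_t$ i.i.d. $N(0,\sigma^2I_d)$ independent of everything else. Datasets $\mathcal{D},\mathcal{D}'\in\mathcal{X}^n$ are adjacent if they differ in exactly one index $i^\star$; $W_t,W_t'$ denote iterates on $\mathcal{D},\mathcal{D}'$ with the same $W_0$ and batch sequence. The algorithm outputting $W_T$ is $(\alpha,\varepsilon)$-RDP if $D_\alpha(W_T\|W_T')\le\varepsilon$ for all adjacent pairs, where $D_\alpha(\mu\|\nu)=\frac{1}{\alpha-1}\log\int(\mu/\nu)^\alpha d\nu$ if $\mu\ll\nu$, $+\infty$ otherwise. A map $f:\mathcal{K}\to\mathbb{R}^d$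 is $(L,\lambda)$-Hölder continuous if $\|f(w)-f(w')\|\le L\|w-w'\|^\lambda$ for all $w,w'\in\mathcal{K}$. Conventions: $x/0=+\infty$ for $x>0$, $0/0=0$. *)

(* Defs.v *)
From HB Require Import structures.
From mathcomp Require Import all_boot all_order all_algebra.
From mathcomp Require Import all_classical all_reals all_analysis.
Unset Printing Implicit Defensive.
Import Order.TTheory GRing.Theory Num.Theory.
Import numFieldNormedType.Exports.
Local Open Scope classical_set_scope.
Local Open Scope ring_scope.

Definition dotp {R : realType} {d : nat} (u v : 'rV[R]_d) : R :=
  \sum_(i < d) u ord0 i * v ord0 i.

Definition enorm {R : realType} {d : nat} (v : 'rV[R]_d) : R := Num.sqrt (dotp v v).

(** Pi_{B_K}(v) = v * min(1, K/||v||)  (for v = 0 both sides are 0) *)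
Definition clipK {R : realType} {d : nat} (K : R) (v : 'rV[R]_d) : 'rV[R]_d :=
  Num.min 1 (K / enorm v) *: v.

Definition has_diameter {R : realType} {d : nat} (C : set 'rV[R]_d) (D : R) : Prop :=
  (forall x y, C x -> C y -> enorm (x - y) <= D) /\
  (forall e : R, 0 < e -> exists x y, [/\ C x, C y & D - e < enorm (x - y)]).

Definition is_euclid_proj {R : realType} {d : nat} (C : set 'rV[R]_d)
    (P : 'rV[R]_d -> 'rV[R]_d) : Prop :=
  forall x, C (P x) /\ forall y, C y -> enorm (x - P x) <= enorm (x - y).

Definition is_gradient_on {R : realType} {d : nat} (C : set 'rV[R]_d)
    (f : 'rV[R]_d -> R) (gr : 'rV[R]_d -> 'rV[R]_d) : Prop :=
  forall w, C w -> differentiable f w /\ forall v, 'd f w v = dotp (gr w) v.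

Definition holder_on {R : realType} {d : nat} (C : set 'rV[R]_d) (L lam : R)
    (f : 'rV[R]_d -> 'rV[R]_d) : Prop :=
  forall w w', C w -> C w' -> enorm (f w - f w') <= L * (enorm (w - w') `^ lam).

Definition adjacent_datasets {X : Type} {n : nat} (Ds Ds' : 'I_n -> X) : Prop :=
  exists i, Ds i <> Ds' i /\ forall j, j != i -> Ds j = Ds' j.

Definition nsgd_step {R : realType} {d n : nat} (PK : 'rV[R]_d -> 'rV[R]_d)
    (eta K : R) (grads : 'I_n -> 'rV[R]_d -> 'rV[R]_d) (w g : 'rV[R]_d) : 'rV[R]_d :=
  PK (w - eta *: (n%:R^-1 *: \sum_(i < n) clipK K (grads i w)) + g).

Fixpoint nsgd_iter {R : realType} {d n : nat} (PK : 'rV[R]_d -> 'rV[R]_d)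
    (eta K : R) (grads : 'I_n -> 'rV[R]_d -> 'rV[R]_d) (W0 : 'rV[R]_d)
    (G : nat -> 'rV[R]_d) (t : nat) : 'rV[R]_d :=
  match t with
  | 0 => W0
  | t'.+1 => nsgd_step PK eta K grads (nsgd_iter PK eta K grads W0 G t') (G t')
  end.

(** Borel sigma-algebra on R^d (generated by the coordinate maps) *)
Definition rV_gen {R : realType} (d : nat) : set (set 'rV[R]_d) :=
  [set A | exists (i : 'I_d) (B : set R),
     measurable B /\ A = (fun v : 'rV[R]_d => v ord0 i) @^-1` B].
Definition rVm {R : realType} (d : nat) := g_sigma_algebraType (@rV_gen R d).

Definition mutually_independent {R : realType} {dO : measure_display}
    {O : measurableType dO} (P : probability O R) {I : finType} (Y : I -> O -> R) : Prop :=
  forall B : I -> set R, (forall k, measurable (B k)) ->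
    P (\bigcap_(k in [set: I]) (Y k @^-1` B k)) = (\prod_(k : I) P (Y k @^-1` B k))%E.

(** G_t, t in N, i.i.d. with law N(0, sigma^2 I_d): all coordinates of all G_t
    are independent real N(0, sigma^2) random variables *)
Definition iid_gaussian_noise {R : realType} {dO : measure_display}
    {O : measurableType dO} (P : probability O R) (d : nat) (sigma : R)
    (G : nat -> O -> 'rV[R]_d) : Prop :=
  [/\ (forall t i, measurable_fun [set: O] (fun w => G t w ord0 i)),
      (forall t i B, measurable B ->
          P ((fun w => G t w ord0 i) @^-1` B) = normal_prob 0 sigma B) &
      (forall T' : nat, mutually_independent P
          (fun k : 'I_T' * 'I_d => fun w => G k.1 w ord0 k.2)) ].

Definition eln {R : realType} (x : \bar R) : \bar R :=
  match x with
  | r%:E => if (r == 0)%R then -oo else (ln r)%:E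
  | +oo => +oo
  | -oo => -oo
  end%E.

(** f is a density (Radon-Nikodym derivative) of the law of X w.r.t. the law of Y,
    both random variables on (O, P) with values in R^d; the integral against
    the law of Y is written on O (change of variables). *)
Definition is_law_density {R : realType} {dO : measure_display}
    {O : measurableType dO} (P : probability O R) {d : nat}
    (X Y : O -> @rVm R d) (f : @rVm R d -> R) : Prop :=
  [/\ measurable_fun [set: @rVm R d] f, (forall x, 0 <= f x) &
      forall A : set (@rVm R d), measurable A ->
        P (X @^-1` A) = (\int[P]_(w in Y @^-1` A) (f (Y w))%:E)%E ].

(** Renyi divergence D_alpha(law X || law Y): +oo if law X is not absolutely
    continuous w.r.t. law Y (i.e. has no density), otherwise
    1/(alpha-1) log int (dmu/dnu)^alpha dnu. *)
Definition renyi_div {R : realType} {dO : measure_display}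
    {O : measurableType dO} (P : probability O R) {d : nat}
    (alpha : R) (X Y : O -> @rVm R d) : \bar R :=
  match pselect (exists f, is_law_density P X Y f) with
  | left H => let f := projT1 (cid H) in
      (((alpha - 1)^-1)%:E * eln (\int[P]_w ((f (Y w)) `^ alpha)%:E))%E
  | right _ => +oo%E
  end.

Definition ediv {R : realType} (x y : R) : \bar R :=
  if y == 0 then (if x == 0 then 0%E else +oo%E) else (x / y)%:E.

Definition gfun {R : realType} (eta L lam : R) (x : R) : R := x + eta * L * (x `^ lam).

Definition hfun {R : realType} (eta L lam : R) (y : R) : R :=
  xget 0 [set x | 0 <= x /\ gfun eta L lam x = y].

Fixpoint Dseq {R : realType} (eta L lam K D : R) (n : nat) (t : nat) : R :=
  match t with
  | 0 => 0
  | t'.+1 => Num.min (Num.min (gfun eta L lam (Dseq eta L lam K D n t') + 2 * eta * K / n%:R)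
                              (Dseq eta L lam K D n t' + 2 * eta * K)) D
  end.

(** Arec k = A_{T-k}:  A_T = 0,  A_{t-1} = h(A_t + a_{t-1}) *)
Fixpoint Arec {R : realType} (eta L lam : R) (a : nat -> R) (T : nat) (k : nat) : R :=
  match k with
  | 0 => 0
  | k'.+1 => hfun eta L lam (Arec eta L lam a T k' + a (T - k'.+1)%N)
  end.
Definition Aseq {R : realType} (eta L lam : R) (a : nat -> R) (T t : nat) : R :=
  Arec eta L lam a T (T - t).

Definition eps_bound {R : realType} (alpha sigma eta K : R) (n T tau : nat)
    (beta a : nat -> R) : \bar R :=
  ((alpha / (2 * sigma ^+ 2))%:E *
   \sum_(tau <= t < T) (ediv ((2 * eta * K / n%:R) ^+ 2) (beta t)
                         + ediv (a t ^+ 2) (1 - beta t)))%E.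

(* Main.v *)
Require Import Defs.
From HB Require Import structures.
From mathcomp Require Import all_boot all_order all_algebra.
From mathcomp Require Import all_classical all_reals all_analysis.
From mathcomp Require Import measurable_realfun ring lra zify.
Import Order.TTheory GRing.Theory Num.Theory.
Import numFieldNormedType.Exports.
Import Defs.
Local Open Scope classical_set_scope.
Local Open Scope ring_scope.

(** A Girsanov coupling. Let Y be the run on the second dataset, driven by the
    noise y, and let U be driven by the same noise with the first dataset's
    gradient map phi, except that its noise is shifted to y_t - v_t. From time
    tau on, v_t = phi(Y_t) - phi'(Y_t) + c_t, where c_t is phi(U_t) - phi(Y_t)
    clipped to length a_t. Pathwise, |U_t - Y_t| is at most D_t up to time tau
    and at most A_t afterwards, so U_T = Y_T. The drift v is adapted, so under
    the measure with density M = exp((sum <y_t, v_t> - |v_t|^2 / 2) / sigma^2)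
    the shifted noise is again i.i.d. Gaussian and U_T has the law of the run W
    on the first dataset. Thus P(W_T in A) = E[M 1_{Y_T in A}]: the density of
    the law of W_T with respect to that of Y_T is a conditional expectation of
    M, and its alpha-th moment is at most E[M^alpha]. Finally M^alpha is the
    Girsanov density of the drift alpha v times
    exp(alpha (alpha - 1) |v|^2 / (2 sigma^2)), and
    |v_t|^2 <= (2 eta K / n + a_t)^2
            <= (2 eta K / n)^2 / beta_t + a_t^2 / (1 - beta_t). *)

(** * Densities and the Gaussian shift *)

Section Density.
Local Open Scope ereal_scope.
Import HBNNSimple.

(** The formula on sets extends to simple functions by linearity and to [f] by monotone convergence
    along [nnsfun_approx]. *)
Lemma integral_density {d} {T : measurableType d} {R : realType}
    (mu nu : {measure set T -> \bar R}) (m : T -> R) :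
  measurable_fun [set: T] m -> (forall x, (0 <= m x)%R) ->
  (forall A, measurable A -> nu A = \int[mu]_(x in A) (m x)%:E) ->
  forall f : T -> \bar R, measurable_fun [set: T] f -> (forall x, 0 <= f x) ->
  \int[nu]_x f x = \int[mu]_x (f x * (m x)%:E).
Proof.
move=> mm m0 nuE f mf f0.
have mEm : measurable_fun [set: T] (EFin \o m) by exact/measurable_EFinP.
pose h := nnsfun_approx measurableT mf.
have fE x : f x = lim ((EFin \o h n) x @[n --> \oo]).
  by apply/esym/cvg_lim => //; exact: cvg_nnsfun_approx.
have -> : \int[nu]_x f x = lim (\int[nu]_x (EFin \o h n) x @[n --> \oo]).
  under eq_integral do rewrite fE.
  apply: monotone_convergence => //.
  - by move=> n; exact/measurable_EFinP.
  - by move=> n x _ //=; rewrite lee_fin.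
  - by move=> x _ a b ab; rewrite lee_fin; exact/lefP/nd_nnsfun_approx.
have -> : \int[mu]_x (f x * (m x)%:E) =
    lim (\int[mu]_x ((EFin \o h n) x * (m x)%:E) @[n --> \oo]).
  have fg x : f x * (m x)%:E = lim (((EFin \o h n) x * (m x)%:E) @[n --> \oo]).
    apply/esym/cvg_lim => //; apply: cvgeZr => //.
    exact: cvg_nnsfun_approx.
  under eq_integral do rewrite fg.
  apply: monotone_convergence => [//| | |].
  - move=> n; apply/emeasurable_funM => //; exact/measurable_EFinP.
  - by move=> n x _ /=; rewrite mule_ge0 ?lee_fin.
  - by move=> x _ a b ab/=; rewrite lee_wpmul2r ?lee_fin//; exact/lefP/nd_nnsfun_approx.
suff suf n : \int[nu]_x (EFin \o h n) x = \int[mu]_x ((EFin \o h n) x * (m x)%:E).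
  by under eq_fun do rewrite suf.
have indich r : measurable_fun [set: T] (fun x => (r * \1_(h n @^-1` [set r]) x)%:E).
  by apply/measurable_EFinP; exact: measurable_funM.
transitivity (\int[nu]_x (\sum_(y \in range (h n)) (y * \1_(h n @^-1` [set y]) x)%:E)).
  by apply: eq_integral => t tE; rewrite /= fimfunE -fsumEFin.
rewrite ge0_integral_fsum//; last by move=> y x _; exact: nnfun_muleindic_ge0.
transitivity (\int[mu]_x (\sum_(y \in range (h n))
    (y * \1_(h n @^-1` [set y]) x)%:E * (m x)%:E)); last first.
  apply: eq_integral => x _.
  rewrite -ge0_mule_fsuml => [|y]; last exact: nnfun_muleindic_ge0.
  by rewrite fsumEFin // -(fimfunE _ x).
rewrite ge0_integral_fsum//; last 2 first.
  - by move=> y; exact: emeasurable_funM.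
  - by move=> y x _; rewrite mule_ge0 ?lee_fin// -lee_fin nnfun_muleindic_ge0.
apply: eq_fsbigr => r rhn.
under eq_integral do rewrite EFinM.
rewrite integralZl_indic_nnsfun => //.
under [RHS]eq_integral do rewrite EFinM -muleA.
rewrite ge0_integralZl//.
- under [in RHS]eq_integral do rewrite muleC.
  rewrite [in RHS](eq_integral ((EFin \o m) \_ (h n @^-1` [set r]))); last first.
    by move=> x xE; rewrite epatch_indic.
  by rewrite -integral_mkcondr integral_indic// setIT setTI nuE.
- by apply: emeasurable_funM => //; exact/measurable_EFinP.
- by move=> t Et; rewrite mule_ge0 ?lee_fin.
- by move: rhn; rewrite inE => -[t _ <-]; rewrite lee_fin.
Qed.

Lemma density_measure_exists {d} {T : measurableType d} {R : realType}
    (mu : {measure set T -> \bar R}) (m : T -> R) :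
  measurable_fun [set: T] m -> (forall x, (0 <= m x)%R) ->
  exists nu : {measure set T -> \bar R},
    forall A, nu A = \int[mu]_(x in A) (m x)%:E.
Proof.
move=> mm m0; pose nu (A : set T) := \int[mu]_(x in A) (m x)%:E.
have nu0 : nu set0 = 0 by rewrite /nu integral_set0.
have nu_ge0 A : 0 <= nu A by apply: integral_ge0 => x _; rewrite lee_fin.
have nuS : semi_sigma_additive nu.
  move=> F mF tF mUF; rewrite /nu ge0_integral_bigcup//; last 2 first.
  - by apply: measurable_funTS; exact/measurable_EFinP.
  - by move=> x _; rewrite lee_fin.
  apply: is_cvg_ereal_nneg_natsum_cond => n _ _.
  by apply: integral_ge0 => /= x _; rewrite lee_fin.
pose nu' : {measure set T -> \bar R} :=
  HB.pack nu (isMeasure.Build _ _ _ nu nu0 nu_ge0 nuS).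
by exists nu'.
Qed.

End Density.

Section GaussianShift.
Local Open Scope ereal_scope.
Context {R : realType}.
Local Notation leb := (@lebesgue_measure R).

(** The translated Lebesgue measure gives half-open intervals their length, hence is Lebesgue
    measure by uniqueness. *)
Lemma ge0_integral_lebesgue_shift (c : R) (f : R -> \bar R) :
  measurable_fun [set: R] f -> (forall x, 0 <= f x) ->
  \int[leb]_x f (x - c)%R = \int[leb]_x f x.
Proof.
move=> mf f0.
have ms : measurable_fun [set: measurableTypeR R]
    ((fun x => x - c)%R : measurableTypeR R -> measurableTypeR R).
  exact: measurable_funB.
pose s : {mfun measurableTypeR R >-> measurableTypeR R} :=
  HB.pack ((fun x => x - c)%R : measurableTypeR R -> measurableTypeR R)
    (isMeasurableFun.Build _ _ _ _ _ ms).
have sE A : measurable A -> pushforward leb s A = leb A.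
  move=> mA; apply/esym/lebesgue_measure_unique => //= _ [[a b]] _ <-.
  rewrite /pushforward /=.
  have -> : (fun x => x - c)%R @^-1` `]a, b] = `](a + c)%R, (b + c)%R]%classic.
    by apply/seteqP; split => x /=; rewrite !in_itv/= lerBlDr ltrBrDr.
  rewrite !lebesgue_measure_itv/= !lte_fin ltrD2r.
  by case: ifP => // _; rewrite -!EFinD; congr (_%:E); ring.
rewrite -[RHS](@eq_measure_integral _ _ _ setT leb (pushforward leb s)) => [|A mA _].
  by rewrite ge0_integral_pushforward//= => x _.
by exact: sE.
Qed.

(** The likelihood ratio at [x] of N(c, sigma^2) against N(0, sigma^2). *)
Definition gauss_weight (sigma x c : R) : R :=
  expR ((x * c - c ^+ 2 / 2) / sigma ^+ 2).

Lemma normal_pdf_shift (sigma x c : R) : (sigma != 0)%R ->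
  (gauss_weight sigma x c * normal_pdf 0 sigma x = normal_pdf 0 sigma (x - c))%R.
Proof.
move=> s0; rewrite normal_pdfE// mulrCA; congr (_ * _)%R.
by rewrite /normal_fun -expRD; congr expR; field.
Qed.

Lemma measurable_gauss_weight (sigma c : R) :
  measurable_fun [set: R] (fun x => gauss_weight sigma x c).
Proof.
apply: measurableT_comp => //; apply: measurable_funM => //.
by apply: measurable_funB => //; apply: measurable_funM.
Qed.

Lemma ge0_integral_normal_prob (sigma : R) (f : R -> \bar R) :
  measurable_fun [set: R] f -> (forall x, 0 <= f x) ->
  \int[normal_prob 0%R sigma]_x f x = \int[leb]_x (f x * (normal_pdf 0 sigma x)%:E).
Proof.
move=> mf f0; apply: (@integral_density _ (measurableTypeR R) R leb
  (normal_prob 0 sigma) (normal_pdf 0 sigma)) => //.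
- exact: measurable_normal_pdf.
- by move=> x; exact: normal_pdf_ge0.
Qed.

(** Girsanov in one variable: the weight recentres the law at [c], and translation invariance of
    Lebesgue measure brings it back to 0. *)
Lemma gauss_weight_normal_prob (sigma c : R) (B : set R) : (sigma != 0)%R ->
  measurable B ->
  \int[normal_prob 0%R sigma]_x (gauss_weight sigma x c * \1_B (x - c))%:E =
  normal_prob 0%R sigma B.
Proof.
move=> s0 mB.
have mB1 : measurable_fun [set: R] (fun x => \1_B (x - c)%R : R).
  apply: (measurableT_comp (f := \1_B : R -> R)) => //.
  exact: measurable_funB.
rewrite ge0_integral_normal_prob; last 2 first.
- by apply/measurable_EFinP; apply: measurable_funM => //; exact: measurable_gauss_weight.
- by move=> x; rewrite lee_fin mulr_ge0// expR_ge0.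
under eq_integral => x _.
  rewrite -EFinM mulrAC normal_pdf_shift//.
  over.
rewrite (ge0_integral_lebesgue_shift c (fun x => (normal_pdf 0 sigma x * \1_B x)%:E)).
- rewrite /normal_prob [RHS]integral_mkcond.
  by apply: eq_integral => x _; rewrite epatch_indic EFinM.
- by apply/measurable_EFinP; apply: measurable_funM => //; exact: measurable_normal_pdf.
- by move=> x; rewrite lee_fin mulr_ge0// normal_pdf_ge0.
Qed.

End GaussianShift.

(** * Girsanov's theorem for finitely many Gaussian variables *)

Definition image_measure {d1 d2} {T1 : measurableType d1} {T2 : measurableType d2}
    {R : realType} (m : {measure set T1 -> \bar R}) {f : T1 -> T2}
    (mf : measurable_fun [set: T1] f) : {measure set T2 -> \bar R} :=
  measure_function_pushforward__canonical__measure_function_Measure m mf.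

Lemma ge0_integral_image_measure {d1 d2} {T1 : measurableType d1}
    {T2 : measurableType d2} {R : realType} (m : {measure set T1 -> \bar R})
    (f : T1 -> T2) (mf : measurable_fun [set: T1] f) (g : T2 -> \bar R) :
  measurable_fun [set: T2] g -> (forall y, 0 <= g y)%E ->
  (\int[image_measure m mf]_y g y = \int[m]_x g (f x))%E.
Proof. by move=> mg g0; rewrite ge0_integral_pushforward. Qed.

Lemma measurable_prod_cond {d} {T : measurableType d} {R : realType} {J : finType}
    (C : pred J) (h : J -> T -> R) :
  (forall i, C i -> measurable_fun [set: T] (h i)) ->
  measurable_fun [set: T] (fun x => \prod_(i | C i) h i x).
Proof.
have E x : \prod_(i | C i) h i x = \prod_i (if C i then h i x else 1).
  exact: big_mkcond.
move=> mh; under eq_fun do rewrite E.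
apply: measurable_prod => i _; have [Ci|_] := boolP (C i); first exact: mh.
exact: measurable_cst.
Qed.

(** * The product sigma-algebra on a finite family of reals *)

Definition box {R : realType} {I : finType} (B : I -> set R) : set (I -> R) :=
  [set x | forall i, B i (x i)].

Definition boxes (R : realType) (I : finType) : set (set (I -> R)) :=
  [set A | exists B : I -> set R, (forall i, measurable (B i)) /\ A = box B].

(** Boxes are taken as generators because [mutually_independent] prescribes the joint law exactly on
    them. *)
Definition boxT (R : realType) (I : finType) := g_sigma_algebraType (@boxes R I).

Section Box.
Context {R : realType} {I : finType}.
Local Notation S := (boxT R I).

Lemma measurable_box (B : I -> set R) : (forall i, measurable (B i)) ->
  measurable (box B : set S).
Proof. by move=> mB; apply: sub_sigma_algebra; exists B. Qed.

Lemma measurable_coord (i : I) : measurable_fun [set: S] (fun x : S => x i).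
Proof.
move=> _ A mA; rewrite setTI.
have -> : (fun x : S => x i) @^-1` A = box (fun j => if j == i then A else setT).
  apply/seteqP; split => x /= Ax; last by have := Ax i; rewrite eqxx.
  by move=> j; case: eqP => [->|].
by apply: measurable_box => j; case: ifP.
Qed.

Lemma box_bigcap {T : Type} (X : T -> I -> R) (B : I -> set R) :
  X @^-1` box B = \bigcap_(k in [set: I]) ((fun w => X w k) @^-1` B k).
Proof. by apply/seteqP; split => x /= h i; [move=> _|]; exact: h. Qed.

Lemma measurable_fun_box d (T : measurableType d) (X : T -> S) :
  (forall i, measurable_fun [set: T] (fun w => X w i)) ->
  measurable_fun [set: T] X.
Proof.
move=> mX; apply: (@measurability _ _ T S setT X (@boxes R I)) => // _ [_ [B [mB ->]] <-].
rewrite setTI box_bigcap.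
apply: fin_bigcap_measurable => // i _.
by rewrite -(setTI (_ @^-1` _)); exact: mX.
Qed.

(** Boxes form a pi-system containing the whole space, so the uniqueness theorem for measures
    applies. *)
Lemma box_measure_unique (m1 m2 : {measure set S -> \bar R}) :
  (m1 setT < +oo)%E ->
  (forall B, (forall i, measurable (B i)) -> m1 (box B) = m2 (box B)) ->
  forall A, measurable A -> m1 A = m2 A.
Proof.
move=> m1oo m12; have boxT' : box (fun _ : I => [set: R]) = setT.
  by apply/seteqP; split.
move=> A mA; apply: (@measure_unique _ R S (@boxes R I) (fun _ => setT)) => //.
- move=> _ _ [B [mB ->]] [C [mC ->]]; exists (fun i => B i `&` C i); split.
    by move=> i; exact: measurableI.
  apply/seteqP; split => x /=; first by move=> [h1 h2] i; split.
  by move=> h; split => i; have [] := h i.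
- by move=> _; exists (fun _ => setT); split.
- by apply/seteqP; split => // x _; exists 0%N.
- by move=> _ [B [mB ->]]; exact: m12.
Qed.

End Box.

(** Encodes adaptedness without filtrations: a function depends only on the coordinates of rank
    below [k] when it is invariant under [trunc rk k]. *)
Definition trunc {R : realType} {I : finType} (rk : I -> nat) (k : nat)
  (x : I -> R) : I -> R := fun i => if (rk i < k)%N then x i else 0.

Section Girsanov.
Local Open Scope ereal_scope.
Context {R : realType} {dO : measure_display} {O : measurableType dO}.
Context {I : finType}.
Variables (P : probability O R) (sigma : R) (xi : I -> O -> R) (rk : I -> nat).
Hypothesis s0 : (sigma != 0)%R.
Hypothesis mxi : forall i, measurable_fun [set: O] (xi i).
Hypothesis xi_law : forall i B, measurable B -> P (xi i @^-1` B) = normal_prob 0%R sigma B.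
Hypothesis xi_indep : mutually_independent P xi.
Hypothesis rk_inj : injective rk.

Local Notation S := (boxT R I).
Local Notation gamma := (normal_prob 0%R sigma).
Local Notation RR := (measurableTypeR R).
Local Notation X := (fun w => (fun i => xi i w) : S).

Lemma measurable_noise : measurable_fun [set: O] X.
Proof. exact: measurable_fun_box. Qed.

Lemma measurable_trunc k : measurable_fun [set: S] (trunc rk k : S -> S).
Proof.
apply: measurable_fun_box => i; rewrite /trunc; case: (rk i < k)%N => //.
exact: measurable_coord.
Qed.

Lemma noise_box (B : I -> set R) : (forall i, measurable (B i)) ->
  P (X @^-1` box B) = \prod_(i : I) gamma (B i).
Proof.
move=> mB; rewrite box_bigcap xi_indep//.
by apply: eq_bigr => i _; rewrite xi_law.
Qed.

(** For fixed [B] both sides are finite measures in [A], so it suffices to compare them on boxes,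
    where independence gives a product. *)
Lemma noise_past_indep (j : I) (A : set S) (B : set R) :
  measurable A -> measurable B ->
  P ((trunc rk (rk j) \o X) @^-1` A `&` xi j @^-1` B) =
  P ((trunc rk (rk j) \o X) @^-1` A) * gamma B.
Proof.
move=> mA mB; set k := rk j.
have mT : measurable_fun [set: O] (trunc rk k \o X : O -> S).
  by apply: (measurableT_comp (measurable_trunc k)); exact: measurable_noise.
have mBj : measurable (xi j @^-1` B) by rewrite -(setTI (_ @^-1` _)); exact: mxi.
have gfin : gamma B \is a fin_num by exact: fin_num_measure.
have gge0 : (0 <= fine (gamma B))%R by exact: fine_ge0.
pose c := NngNum gge0.
pose m1 : {measure set S -> \bar R} := image_measure (mrestr P mBj) mT.
pose m2 : {measure set S -> \bar R} := mscale c (image_measure P mT).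
have cE : (c%:num)%:E = gamma B by rewrite /= fineK.
suff /(_ A mA) : forall A, measurable A -> m1 A = m2 A.
  by rewrite /m1 /m2 /= /pushforward /mrestr /mscale/= cE muleC => ->.
apply: box_measure_unique.
  rewrite /m1 /= /pushforward /mrestr; apply: le_lt_trans (ltry 1).
  by apply: probability_le1; rewrite preimage_setT setTI.
move=> C mC; rewrite /m1 /m2 /= /mscale /= cE /pushforward /mrestr.
(* Coordinates of rank at least [k] are truncated to the constant 0: a side of the box missing 0
   there makes the preimage empty, and otherwise that side imposes no condition. *)
have [h0|] := pselect (forall i, ~~ (rk i < k)%N -> C i 0%R); last first.
  move=> /existsNP[i /not_implyP[ik C0]].
  have -> : (trunc rk k \o X) @^-1` box C = set0.
    apply/seteqP; split => // w /= /(_ i).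
    by rewrite /trunc (negbTE ik).
  by rewrite set0I !measure0 mule0.
pose C1 i := if (rk i < k)%N then C i else setT.
pose C2 i := if i == j then B else C1 i.
have mC1 i : measurable (C1 i) by rewrite /C1; case: ifP.
have mC2 i : measurable (C2 i) by rewrite /C2; case: ifP.
have C1j : C1 j = setT by rewrite /C1 /k ltnn.
have -> : (trunc rk k \o X) @^-1` box C = X @^-1` box C1.
  apply/seteqP; split => w /= h i; have := h i; rewrite /C1 /trunc; case: ifP => //.
  by move=> /negbT ik _; exact: h0.
have -> : X @^-1` box C1 `&` xi j @^-1` B = X @^-1` box C2.
  apply/seteqP; split => w /=.
    by move=> [h hB] i; rewrite /C2; case: eqP => [->//|_]; exact: h.
  move=> h; split; last by have := h j; rewrite /C2 eqxx.
  by move=> i; have := h i; rewrite /C2; case: eqP => [->|//]; rewrite C1j.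
rewrite !noise_box// (bigD1 j)//= [in RHS](bigD1 j)//= C1j /C2 eqxx.
rewrite probability_setT mul1e; congr (_ * _).
by apply: eq_bigr => i /negbTE ->.
Qed.

(** The past and [xi j] have a product joint law, so Tonelli integrates [xi j] out with the past
    held fixed. *)
Lemma noise_freeze (j : I) (F : S * RR -> \bar R) :
  measurable_fun [set: S * RR] F -> (forall z, 0 <= F z) ->
  \int[P]_w F (trunc rk (rk j) (X w), xi j w) =
  \int[P]_w \int[gamma]_x F (trunc rk (rk j) (X w), x).
Proof.
move=> mF F0; set k := rk j.
have mT : measurable_fun [set: O] (trunc rk k \o X : O -> S).
  by apply: (measurableT_comp (measurable_trunc k)); exact: measurable_noise.
have mTx : measurable_fun [set: O] (fun w => ((trunc rk k \o X) w : S, xi j w : RR)).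
  by apply: measurable_fun_pair => //; exact: mxi.
pose T : {mfun O >-> S} := HB.pack (trunc rk k \o X : O -> S)
  (isMeasurableFun.Build _ _ _ _ _ mT).
pose m1 : probability S R := distribution P T.
have prodE (Z : set (S * RR)) : measurable Z ->
    (m1 \x gamma) Z = (image_measure P mTx) Z.
  move=> mZ. apply: (@product_measure_unique _ _ _ _ _ m1 gamma
    (image_measure P mTx)) => // A B mA mB.
  by rewrite /m1 /= /distribution /pushforward /= -noise_past_indep.
transitivity (\int[image_measure P mTx]_z F z).
  by rewrite ge0_integral_image_measure.
rewrite -(@eq_measure_integral _ _ _ setT (image_measure P mTx) (m1 \x gamma)); last first.
  by move=> A mA _; exact: prodE.
rewrite (fubini_tonelli1 F)// /m1 /distribution.
rewrite ge0_integral_pushforward//; first exact: measurable_fun_fubini_tonelli_F.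
by move=> x _; apply: integral_ge0.
Qed.

Lemma trunc_trunc (k l : nat) (x : I -> R) : (k <= l)%N ->
  trunc rk k (trunc rk l x) = trunc rk k x.
Proof.
move=> kl; apply/funext => i; rewrite /trunc; case: ifP => // ik.
by rewrite (leq_trans ik kl).
Qed.

Section Drift.
Variable v : I -> S -> R.
Hypothesis mv : forall i, measurable_fun [set: S] (v i).
Hypothesis v_adapted : forall i x, v i x = v i (trunc rk (rk i) x).

Let wt (B : I -> set R) (i : I) (x : S) : R :=
  (gauss_weight sigma (x i) (v i x) * \1_(B i) (x i - v i x))%R.

Lemma measurable_weight d (T : measurableType d) (y c : T -> R) (B : set R) :
  measurable B -> measurable_fun [set: T] y -> measurable_fun [set: T] c ->
  measurable_fun [set: T]
    (fun t => gauss_weight sigma (y t) (c t) * \1_B (y t - c t) : R)%R.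
Proof.
move=> mB my mc; apply: measurable_funM.
  apply: measurableT_comp => //; apply: measurable_funM => //.
  apply: measurable_funB; first exact: measurable_funM.
  by apply: measurable_funM => //; exact: measurable_funX.
apply: (measurableT_comp (f := \1_B : R -> R)) => //.
exact: measurable_funB.
Qed.

(** Induction on the rank. Once the past is frozen, the drift of the newest coordinate is a
    constant, and the one-variable formula returns [gamma (B j)] whatever the past was. *)
Lemma girsanov_rank (B : I -> set R) (k : nat) : (forall i, measurable (B i)) ->
  \int[P]_w (\prod_(i | (rk i < k)%N) wt B i (X w))%:E =
  \prod_(i | (rk i < k)%N) gamma (B i).
Proof.
move=> mB; elim: k => [|k IH].
  rewrite big_pred0//; under eq_integral do rewrite big_pred0//.
  by rewrite integral_cst// mul1e; exact: probability_setT.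
(* [rk] is injective but may skip values; at a skipped [k] the product does not change. *)
have [j /eqP jk|nok] := pickP (fun i => rk i == k); last first.
  have rkS i : (rk i < k.+1)%N = (rk i < k)%N.
    by rewrite ltnS leq_eqVlt nok.
  under eq_integral do rewrite (eq_bigl _ _ rkS).
  by rewrite (eq_bigl _ _ rkS).
have rkS i : (rk i < k.+1)%N && (i != j) = (rk i < k)%N.
  have [->|ij] := eqVneq i j; first by rewrite jk ltnn andbF.
  rewrite andbT ltnS leq_eqVlt; case: eqP => //= ik.
  by move: ij; rewrite (rk_inj i j) ?eqxx// ik.
have bigS (U : Type) (idx : U) (op : Monoid.com_law idx) (F : I -> U) :
    \big[op/idx]_(i | (rk i < k.+1)%N) F i = op (F j) (\big[op/idx]_(i | (rk i < k)%N) F i).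
  by rewrite (bigD1 j) ?jk//= (eq_bigl _ _ rkS).
rewrite bigS /= -IH.
pose Z (x : S) : R := (\prod_(i | (rk i < k)%N) wt B i x)%R.
have Z0 x : (0 <= Z x)%R by apply: prodr_ge0 => i _; rewrite mulr_ge0// expR_ge0.
have mZ : measurable_fun [set: S] Z.
  apply: measurable_prod_cond => i _; apply: measurable_weight => //.
  exact: measurable_coord.
have ZT x : Z (trunc rk k x) = Z x.
  apply: eq_bigr => i ik; rewrite /wt v_adapted trunc_trunc 1?ltnW// -v_adapted.
  by rewrite /trunc ik.
pose F (z : S * RR) : \bar R :=
  (Z z.1 * (gauss_weight sigma z.2 (v j z.1) * \1_(B j) (z.2 - v j z.1)))%:E.
have mF : measurable_fun [set: S * RR] F.
  apply/measurable_EFinP; apply: measurable_funM.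
    exact: measurableT_comp.
  apply: measurable_weight => //.
  exact: (measurableT_comp (mv j) measurable_fst).
have F0 z : 0 <= F z by rewrite lee_fin !mulr_ge0// expR_ge0.
transitivity (\int[P]_w F (trunc rk (rk j) (X w), xi j w)).
  apply: eq_integral => w _.
  by rewrite bigS /F /= jk ZT -[in v j _]jk -v_adapted mulrC.
rewrite noise_freeze//.
under eq_integral => w _.
  rewrite /F /=.
  under eq_integral do rewrite EFinM.
  rewrite ge0_integralZl//; last 3 first.
  - apply/measurable_EFinP; apply: measurable_weight => //.
  - by move=> x _; rewrite lee_fin mulr_ge0// expR_ge0.
  - by rewrite lee_fin.
  rewrite gauss_weight_normal_prob// jk ZT.
  over.
rewrite ge0_integralZr//.
- by rewrite muleC.
- by apply/measurable_EFinP; apply: (measurableT_comp mZ); exact: measurable_noise.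
- by move=> w _; rewrite lee_fin.
Qed.

(** The discrete Girsanov exponential M; [shift_densityE] gives its usual form. *)
Definition shift_density (x : S) : R := (\prod_i gauss_weight sigma (x i) (v i x))%R.

Definition drifted (x : S) : S := fun i => (x i - v i x)%R.

Lemma shift_density_ge0 x : (0 <= shift_density x)%R.
Proof. by apply: prodr_ge0 => i _; exact: expR_ge0. Qed.

Lemma measurable_shift_density : measurable_fun [set: S] shift_density.
Proof.
apply: measurable_prod_cond => i _.
apply: measurableT_comp => //; apply: measurable_funM => //.
apply: measurable_funB; first by apply: measurable_funM => //; exact: measurable_coord.
by apply: measurable_funM => //; exact: measurable_funX.
Qed.

Lemma measurable_drifted : measurable_fun [set: S] drifted.
Proof.
by apply: measurable_fun_box => i; apply: measurable_funB => //; exact: measurable_coord.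
Qed.

(** Both sides are measures of [A]. On boxes the weighted one is computed by [girsanov_rank] and the
    other by [noise_box]. *)
Lemma girsanov (A : set S) : measurable A ->
  \int[P]_(w in [set w | A (drifted (X w))]) (shift_density (X w))%:E =
  P [set w | A (X w)].
Proof.
move=> mA.
have mMX : measurable_fun [set: O] (fun w => shift_density (X w)).
  exact: (measurableT_comp measurable_shift_density measurable_noise).
have [Q QE] := density_measure_exists P (fun w => shift_density (X w)) mMX
  (fun w => shift_density_ge0 (X w)).
have mzX : measurable_fun [set: O] (fun w => drifted (X w) : S).
  exact: (measurableT_comp measurable_drifted measurable_noise).
rewrite -QE.
suff /(_ A mA) : forall A, measurable A ->
    image_measure P measurable_noise A = image_measure Q mzX A by move/esym.
apply: box_measure_unique.
  by rewrite /= /pushforward preimage_setT probability_setT ltry.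
move=> B mB; rewrite /= /pushforward noise_box//.
(* [k] exceeds every rank, so the product over ranks below [k] is the full product. *)
pose k := (\max_i rk i).+1.
have rk_lt i : (rk i < k)%N by rewrite ltnS; exact: leq_bigmax.
have kT : (fun i => rk i < k)%N =1 xpredT by [].
rewrite -(eq_bigl _ _ kT) -girsanov_rank//.
rewrite QE [RHS]integral_mkcond.
apply: eq_integral => w _.
rewrite big_split/= !(eq_bigl _ _ kT) epatch_indic /= -EFinM.
congr (_ * _)%:E; rewrite indicE.
case: (boolP (w \in _)) => [|]; rewrite ?notin_setE ?inE => h.
  by rewrite big1// => i _; rewrite indicE mem_set//; exact: h.
have /existsNP[i Bi] := h.
by rewrite (bigD1 i)//= indicE memNset// mul0r.
Qed.

End Drift.

Lemma shift_densityE (v : I -> S -> R) (x : S) : shift_density v x =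
  expR (\sum_i (x i * v i x - v i x ^+ 2 / 2) / sigma ^+ 2)%R.
Proof. by rewrite expR_sum. Qed.

(** In the exponent the drift [alpha v] costs alpha^2 |v|^2 / 2, the power only alpha |v|^2 / 2; the
    last factor carries the difference. *)
Lemma shift_density_powR (v : I -> S -> R) (alpha : R) (x : S) :
  (shift_density v x `^ alpha =
   shift_density (fun i x => alpha * v i x) x *
   expR (alpha * (alpha - 1) / (2 * sigma ^+ 2) * \sum_i v i x ^+ 2))%R.
Proof.
rewrite !shift_densityE -expRD /powR gt_eqF ?expR_gt0// expRK; congr expR.
rewrite !mulr_sumr -big_split/=; apply: eq_bigr => i _.
by field.
Qed.

(** By [girsanov] on the whole space the density of the drift [alpha v] has integral 1; the
    remaining factor of [shift_density_powR] is bounded through [V]. *)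
Lemma shift_density_moment (v : I -> S -> R) (alpha V : R) : (1 < alpha)%R ->
  (forall i, measurable_fun [set: S] (v i)) ->
  (forall i x, v i x = v i (trunc rk (rk i) x)) ->
  (forall x, \sum_i v i x ^+ 2 <= V)%R ->
  \int[P]_w (shift_density v (X w) `^ alpha)%:E <=
  (expR (alpha * (alpha - 1) / (2 * sigma ^+ 2) * V))%:E.
Proof.
move=> a1 mv v_adapted vV.
pose u i x := (alpha * v i x)%R.
have mu i : measurable_fun [set: S] (u i) by apply: measurable_funM.
have u_adapted i x : u i x = u i (trunc rk (rk i) x) by rewrite /u v_adapted.
have mM (y : I -> S -> R) : (forall i, measurable_fun [set: S] (y i)) ->
    measurable_fun [set: O] (fun w => shift_density y (X w)).
  by move=> my; exact: (measurableT_comp (measurable_shift_density y my) measurable_noise).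
set c := expR _.
have c0 : (0 <= c)%R by exact: expR_ge0.
have := girsanov u mu u_adapted setT measurableT.
rewrite (_ : [set w | [set: S] _] = setT); last by apply/seteqP.
rewrite probability_setT => int1.
rewrite -[leRHS]mule1 -int1 -ge0_integralZl//; last 2 first.
- by apply/measurable_EFinP; exact: mM.
- by move=> w _; rewrite lee_fin shift_density_ge0.
apply: ge0_le_integral => //.
- by move=> w _; rewrite lee_fin powR_ge0.
- by apply/measurable_EFinP; apply: (measurableT_comp (measurable_powR alpha)); exact: mM.
- by apply: measurable_funeM; apply/measurable_EFinP; exact: mM.
move=> w _; rewrite -EFinM lee_fin shift_density_powR mulrC.
rewrite ler_wpM2r ?shift_density_ge0// ler_expR ler_wpM2l//.
have [al0 al1] : (0 <= alpha)%R /\ (0 <= alpha - 1)%R by split; lra.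
by rewrite divr_ge0// mulr_ge0// sqr_ge0.
Qed.

End Girsanov.

(** * Renyi divergence from a coupling density *)

(** Young's inequality for the conjugate exponents [alpha] and [alpha / (alpha - 1)]. *)
Lemma young_powR {R : realType} (alpha x m : R) : 1 < alpha -> 0 <= x -> 0 <= m ->
  x `^ (alpha - 1) * m <= alpha^-1 * m `^ alpha + (1 - alpha^-1) * x `^ alpha.
Proof.
move=> a1 x0 m0.
have a0 : 0 < alpha by lra.
have b0 : 0 < alpha - 1 by lra.
have q0 : 0 < alpha / (alpha - 1) by exact: divr_gt0.
have qE : alpha^-1 + (alpha / (alpha - 1))^-1 = 1 by field; rewrite !gt_eqF.
have := conjugate_powR m0 (powR_ge0 x (alpha - 1)) a0 q0 qE.
have -> : (x `^ (alpha - 1)) `^ (alpha / (alpha - 1)) = x `^ alpha.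
  by rewrite -powRrM; congr (_ `^ _); field; rewrite gt_eqF.
have <- : (alpha / (alpha - 1))^-1 = 1 - alpha^-1 by field; rewrite !gt_eqF.
by rewrite mulrC [in leRHS]mulrC (mulrC (x `^ alpha)).
Qed.

Section RenyiCoupling.
Local Open Scope ereal_scope.
Context {R : realType} {dO : measure_display} {O : measurableType dO}.
Variables (P : probability O R) (d : nat).
Local Notation V := (@rVm R d).
Variables (X Y : O -> V) (M : O -> R).
Hypothesis mX : measurable_fun [set: O] X.
Hypothesis mY : measurable_fun [set: O] Y.
Hypothesis mM : measurable_fun [set: O] M.
Hypothesis M0 : forall w, (0 <= M w)%R.
Hypothesis MXY : forall A : set V, measurable A ->
  P (X @^-1` A) = \int[P]_(w in Y @^-1` A) (M w)%:E.

(** [MXY] makes the law of [X] absolutely continuous with respect to that of [Y], so Radon-Nikodym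
    applies. This excludes the infinite branch of [renyi_div]. *)
Lemma law_density_exists : exists f, is_law_density P X Y f.
Proof.
pose X' : {mfun O >-> V} := HB.pack X (isMeasurableFun.Build _ _ _ _ _ mX).
pose Y' : {mfun O >-> V} := HB.pack Y (isMeasurableFun.Build _ _ _ _ _ mY).
pose nu : probability V R := distribution P X'.
pose mu : probability V R := distribution P Y'.
have numu : nu `<< mu.
  apply/null_content_dominatesP => A mA mu0.
  rewrite /nu /= /distribution /pushforward MXY//.
  have mYA : measurable (Y @^-1` A) by rewrite -(setTI (_ @^-1` _)); exact: mY.
  apply: null_set_integral => //.
  by apply: measurable_funTS; exact/measurable_EFinP.
have [f [f0 ffin /measurable_int mf fE]] := radon_nikodym_sigma_finite numu.
exists (fine \o f); split => [|x|A mA].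
- exact: measurableT_comp.
- exact: fine_ge0.
have -> : P (X @^-1` A) = nu A by [].
rewrite fE// /mu /distribution ge0_integral_pushforward//; last exact: measurable_funTS.
by apply: eq_integral => w _; rewrite /= fineK.
Qed.

(** The weak form of f(Y) = E[M | Y], tested against functions of [Y]. It covers every density [f],
    since [renyi_div] picks one by choice. *)
Lemma integral_law_density (f : V -> R) (h : V -> \bar R) :
  is_law_density P X Y f -> measurable_fun [set: V] h -> (forall x, 0 <= h x) ->
  \int[P]_w (h (Y w) * (f (Y w))%:E) = \int[P]_w (h (Y w) * (M w)%:E).
Proof.
move=> [mf f0 fE] mh h0.
have [Q QE] := density_measure_exists P M mM M0.
transitivity (\int[image_measure P mY]_y (h y * (f y)%:E)).
  rewrite ge0_integral_image_measure//.
  - by apply: emeasurable_funM => //; exact/measurable_EFinP.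
  - by move=> y; rewrite mule_ge0// lee_fin.
rewrite -(@integral_density _ V R (image_measure P mY) (image_measure Q mY))//.
  rewrite ge0_integral_image_measure//.
  apply: (@integral_density _ O R P Q M) => //.
  exact: measurableT_comp.
move=> A mA; rewrite /= /pushforward QE -MXY// fE//.
rewrite ge0_integral_pushforward//.
- by apply: measurable_funTS; exact/measurable_EFinP.
- by move=> y _; rewrite lee_fin.
Qed.

(** Plays the part of conditional Jensen. For fN = min(f, N), E[fN^alpha] <= E[fN^(alpha-1) f] =
    E[fN^(alpha-1) M], which Young bounds by E[M^alpha] / alpha + (1 - 1/alpha) E[fN^alpha]; the
    last term is absorbed on the left. *)
Lemma law_density_moment (f : V -> R) (alpha c : R) :
  is_law_density P X Y f -> (1 < alpha)%R ->
  \int[P]_w (M w `^ alpha)%:E <= c%:E ->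
  \int[P]_w (f (Y w) `^ alpha)%:E <= c%:E.
Proof.
move=> fXY a1 Mc; have [mf f0 _] := fXY.
have a0 : (0 < alpha)%R by lra.
have ai : (0 < alpha^-1)%R by rewrite invr_gt0.
have ai1 : (alpha^-1 < 1)%R by rewrite invf_lt1.
pose fN (N : nat) (y : V) : R := Num.min (f y) N%:R.
have fN0 N y : (0 <= fN N y)%R by rewrite /fN le_min f0 ler0n.
have mfN N : measurable_fun [set: V] (fN N) by exact: measurable_minr.
have mp (r : R) (g : O -> R) : measurable_fun [set: O] g ->
    measurable_fun [set: O] (fun w => (g w `^ r)%:E).
  by move=> mg; apply/measurable_EFinP; apply: (measurableT_comp (measurable_powR r)).
have mfNY N : measurable_fun [set: O] (fun w => fN N (Y w)) by exact: measurableT_comp.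
pose aN N := \int[P]_w (fN N (Y w) `^ alpha)%:E.
(* The cap [N] makes this moment finite, as the absorption requires. *)
have aN_fin N : aN N \is a fin_num.
  rewrite ge0_fin_numE; last by apply: integral_ge0 => w _; rewrite lee_fin powR_ge0.
  apply: (@le_lt_trans _ _ (\int[P]_w (N%:R `^ alpha)%:E)).
    apply: ge0_le_integral => //.
    - by move=> w _; rewrite lee_fin powR_ge0.
    - exact: mp.
    - move=> w _; rewrite lee_fin ge0_ler_powR// ?nnegrE//; first exact: ltW.
      by rewrite /fN ge_min lexx orbT.
  rewrite integral_cst//= probability_setT mule1 ltry.
  by [].
have aN_le N : aN N <= c%:E.
  have h1 : aN N <= \int[P]_w ((fN N (Y w) `^ (alpha - 1))%:E * (f (Y w))%:E).
    apply: ge0_le_integral => //.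
    - by move=> w _; rewrite lee_fin powR_ge0.
    - exact: mp.
    - by apply: emeasurable_funM; [exact: mp|apply/measurable_EFinP; exact: measurableT_comp].
    - move=> w _; rewrite -EFinM lee_fin -mulr_powRB1// mulrC ler_wpM2l ?powR_ge0//.
      by rewrite /fN ge_min lexx.
  rewrite (integral_law_density f (fun y => (fN N y `^ (alpha - 1))%:E)) in h1 => //; last 2 first.
  - by apply/measurable_EFinP; apply: (measurableT_comp (measurable_powR _)).
  - by move=> y; rewrite lee_fin powR_ge0.
  have h2 : aN N <= (alpha^-1 * c)%:E + (1 - alpha^-1)%:E * aN N.
    apply: (le_trans h1).
    apply: (@le_trans _ _ (\int[P]_w ((alpha^-1)%:E * (M w `^ alpha)%:E +
        (1 - alpha^-1)%:E * (fN N (Y w) `^ alpha)%:E))).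
      apply: ge0_le_integral => //.
      - by move=> w _; rewrite mule_ge0// lee_fin// powR_ge0.
      - by apply: emeasurable_funM; [exact: mp|exact/measurable_EFinP].
      - by apply: emeasurable_funD; apply: measurable_funeM; exact: mp.
      - by move=> w _; rewrite -!EFinM -EFinD lee_fin young_powR.
    have p1 : (0 <= 1 - alpha^-1)%R by lra.
    have p2 : (0 <= alpha^-1)%R by lra.
    rewrite ge0_integralD//; last 4 first.
    - by move=> w _; rewrite mule_ge0// lee_fin ?powR_ge0.
    - by apply: measurable_funeM; exact: mp.
    - by move=> w _; rewrite mule_ge0// lee_fin ?powR_ge0.
    - by apply: measurable_funeM; exact: mp.
    rewrite !ge0_integralZl//; last 4 first.
    - exact: mp.
    - by move=> w _; rewrite lee_fin powR_ge0.
    - exact: mp.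
    - by move=> w _; rewrite lee_fin powR_ge0.
    by rewrite leeD2r// EFinM lee_wpmul2l// lee_fin.
  move: h2; rewrite -(fineK (aN_fin N)) -EFinM -EFinD !lee_fin => h2.
  have : (alpha^-1 * fine (aN N) <= alpha^-1 * c)%R by lra.
  by rewrite ler_pM2l.
(* At each [w] the capped values are eventually constant in [N]; monotone convergence removes the
   cap. *)
have cv : aN N @[N --> \oo] --> \int[P]_w (f (Y w) `^ alpha)%:E.
  have -> : \int[P]_w (f (Y w) `^ alpha)%:E =
      \int[P]_w limn (fun N => (fN N (Y w) `^ alpha)%:E).
    apply: eq_integral => w _; apply/esym/cvg_lim => //.
    apply: cvg_near_cst; near=> N.
    rewrite /fN min_l//; near: N; exact: nbhs_infty_ger.
  apply: cvg_monotone_convergence => //.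
  - by move=> N; exact: mp.
  - by move=> N w _; rewrite lee_fin powR_ge0.
  - move=> w _ N1 N2 N12; rewrite lee_fin ge0_ler_powR// ?nnegrE//; first exact: ltW.
    by rewrite /fN le_min !ge_min lexx/= ler_nat N12 orbT.
rewrite -(cvg_lim _ cv)//; apply: lime_le; first by apply/cvg_ex; eexists; exact: cv.
by near=> N; exact: aN_le.
Unshelve. all: by end_near. Qed.

Lemma renyi_div_coupling_le (alpha c : R) : (1 < alpha)%R ->
  \int[P]_w (M w `^ alpha)%:E <= (expR c)%:E ->
  renyi_div P alpha X Y <= ((alpha - 1)^-1 * c)%:E.
Proof.
move=> a1 Mc; rewrite /renyi_div; case: pselect => [H|]; last first.
  by move=> /(_ law_density_exists).
have := law_density_moment _ _ _ (projT2 (cid H)) a1 Mc.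
set I := \int[P]_w _ => Ic.
have I0 : 0 <= I by apply: integral_ge0 => w _; rewrite lee_fin powR_ge0.
have b0 : (0 < (alpha - 1)^-1)%R by rewrite invr_gt0; lra.
rewrite EFinM lee_pmul2l// ?lte_fin//.
case: I I0 Ic => [r| |]//= r0 rc.
(* A zero integral has [eln] equal to -oo, below any bound. *)
case: eqP => [_|/eqP rn0]; first exact: leNye.
rewrite !lee_fin in r0 rc *.
by rewrite -ler_expR lnK// posrE lt_neqAle eq_sym rn0.
Qed.

End RenyiCoupling.

(** * Euclidean projections and the Hoelder modulus *)

Section Euclid.
Context {R : realType} {d : nat}.
Implicit Types (u v w x y : 'rV[R]_d) (c : R).

Lemma dotpC u v : dotp u v = dotp v u.
Proof. by apply: eq_bigr => i _; rewrite mulrC. Qed.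

Lemma dotpDl u v w : dotp (u + v) w = dotp u w + dotp v w.
Proof. by rewrite -big_split; apply: eq_bigr => i _; rewrite mxE mulrDl. Qed.

Lemma dotpZl c u v : dotp (c *: u) v = c * dotp u v.
Proof. by rewrite mulr_sumr; apply: eq_bigr => i _; rewrite mxE mulrA. Qed.

Lemma dotpNl u v : dotp (- u) v = - dotp u v.
Proof. by rewrite -scaleN1r dotpZl mulN1r. Qed.

Lemma dotpDr u v w : dotp u (v + w) = dotp u v + dotp u w.
Proof. by rewrite dotpC dotpDl !(dotpC _ u). Qed.

Lemma dotpZr c u v : dotp u (c *: v) = c * dotp u v.
Proof. by rewrite dotpC dotpZl dotpC. Qed.

Lemma dotpNr u v : dotp u (- v) = - dotp u v.
Proof. by rewrite dotpC dotpNl dotpC. Qed.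

Definition dotpE := (dotpDl, dotpDr, dotpNl, dotpNr, dotpZl, dotpZr).

Lemma dotp_ge0 u : 0 <= dotp u u.
Proof. by apply: sumr_ge0 => i _; rewrite -expr2 sqr_ge0. Qed.

Lemma enorm_ge0 u : 0 <= enorm u.
Proof. exact: sqrtr_ge0. Qed.

Lemma sqr_enorm u : enorm u ^+ 2 = dotp u u.
Proof. by rewrite sqr_sqrtr// dotp_ge0. Qed.

Lemma enorm_le u c : 0 <= c -> dotp u u <= c ^+ 2 -> enorm u <= c.
Proof. by move=> c0; rewrite -sqr_enorm ler_sqr ?nnegrE ?enorm_ge0. Qed.

Lemma enormZ c u : enorm (c *: u) = `|c| * enorm u.
Proof.
by rewrite /enorm !dotpE mulrA -expr2 sqrtrM ?sqr_ge0// sqrtr_sqr.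
Qed.

Lemma enormN u : enorm (- u) = enorm u.
Proof. by rewrite -scaleN1r enormZ normrN1 mul1r. Qed.

Lemma enorm0 : enorm (0 : 'rV[R]_d) = 0.
Proof. by rewrite -(scale0r 0) enormZ normr0 mul0r. Qed.

Lemma normr_coord_le u (i : 'I_d) : `|u ord0 i| <= enorm u.
Proof.
rewrite -sqrtr_sqr ler_wsqrtr// /dotp (bigD1 i)//= -expr2 lerDl.
by apply: sumr_ge0 => j _; rewrite -expr2 sqr_ge0.
Qed.

Lemma enorm_eq0 u : enorm u = 0 -> u = 0.
Proof.
move=> u0; apply/rowP => i; rewrite mxE.
by apply/eqP; rewrite -normr_le0 -u0 normr_coord_le.
Qed.

Lemma cauchy_schwarz u v : dotp u v <= enorm u * enorm v.
Proof.
have [u0|/eqP u0] := eqVneq (enorm u) 0.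
  by rewrite u0 mul0r (enorm_eq0 _ u0) -(scale0r 0) dotpZl mul0r.
have [v0|v0] := eqVneq (enorm v) 0.
  by rewrite v0 mulr0 (enorm_eq0 _ v0) -(scale0r 0) dotpZr mul0r.
have up : 0 < enorm u by rewrite lt_neqAle enorm_ge0 eq_sym; move/eqP: u0 => ->.
have vp : 0 < enorm v by rewrite lt_neqAle enorm_ge0 eq_sym v0.
have := dotp_ge0 (enorm v *: u - enorm u *: v).
rewrite !dotpE (dotpC v u) -!sqr_enorm => h.
have : 0 <= 2 * (enorm u * enorm v) * (enorm u * enorm v - dotp u v) by nra.
by rewrite pmulr_rge0 ?subr_ge0// !mulr_gt0.
Qed.

Lemma enormD u v : enorm (u + v) <= enorm u + enorm v.
Proof.
apply: enorm_le; first by rewrite addr_ge0// enorm_ge0.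
rewrite !dotpE (dotpC v u) -!sqr_enorm.
have := cauchy_schwarz u v; nra.
Qed.

Lemma enorm_le_sum u : enorm u <= \sum_i `|u ord0 i|.
Proof.
apply: enorm_le; first exact: sumr_ge0.
rewrite expr2 mulr_suml; apply: ler_sum => i _.
rewrite (le_trans (ler_norm _))// normrM ler_wpM2l//.
by rewrite (bigD1 i)//= lerDl; apply: sumr_ge0.
Qed.

(** The variational inequality: no point of the segment from [p x] to [y] is closer to [x] than
    [p x], and points near [p x] force the sign. *)
Lemma euclid_proj_dotp_le0 (C : set 'rV[R]_d) (p : 'rV[R]_d -> 'rV[R]_d) x y :
  (forall z1 z2 t, C z1 -> C z2 -> 0 <= t <= 1 -> C (t *: z1 + (1 - t) *: z2)) ->
  is_euclid_proj C p -> C y -> dotp (x - p x) (y - p x) <= 0.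
Proof.
move=> Cc Pp Cy; have [Cp pmin] := Pp x.
have bil (m l : 'rV[R]_d) t : dotp (m - t *: l) (m - t *: l) =
    dotp m m - 2 * (t * dotp m l) + t * (t * dotp l l).
  by rewrite !dotpE (dotpC l m); ring.
set q := p x in Cp pmin *; set a := dotp _ _; set b := dotp (y - q) (y - q).
have b0 : 0 <= b by exact: dotp_ge0.
have key t : 0 <= t <= 1 -> t * (2 * a) <= t * (t * b).
  move=> t01; have xq := pmin _ (Cc _ _ _ Cy Cp t01).
  have := ler_pM (enorm_ge0 _) (enorm_ge0 _) xq xq; rewrite -!expr2 !sqr_enorm.
  have -> : x - (t *: y + (1 - t) *: q) = (x - q) - t *: (y - q).
    by apply/rowP => i; rewrite !mxE; ring.
  have -> : dotp (x - q - t *: (y - q)) (x - q - t *: (y - q)) =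
      dotp (x - q) (x - q) - 2 * (t * a) + t * (t * b).
    exact: bil.
  by lra.
rewrite leNgt; apply/negP => a0.
(* This [t] lies in (0, 1] and satisfies [t * b <= a], so [key] yields [2 * a <= a], against
   [0 < a]. *)
pose t := a / (a + b + 1).
have s0 : 0 < a + b + 1 by lra.
have t0 : 0 < t by exact: divr_gt0.
have t1 : t <= 1 by rewrite ler_pdivrMr// mul1r; lra.
have := key t; rewrite ltW// t1 => /(_ isT); rewrite ler_pM2l// => h.
have : t * b <= a by rewrite /t mulrAC ler_pdivrMr// ler_wpM2l ?ltW//; lra.
by lra.
Qed.

(** The variational inequalities at [x] and [y] add up to |p x - p y|^2 <= <x - y, p x - p y>;
    Cauchy-Schwarz concludes. *)
Lemma euclid_proj_lipschitz (C : set 'rV[R]_d) (p : 'rV[R]_d -> 'rV[R]_d) x y :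
  (forall z1 z2 t, C z1 -> C z2 -> 0 <= t <= 1 -> C (t *: z1 + (1 - t) *: z2)) ->
  is_euclid_proj C p -> enorm (p x - p y) <= enorm (x - y).
Proof.
move=> Cc Pp.
have h1 := euclid_proj_dotp_le0 _ _ x _ Cc Pp (Pp y).1.
have h2 := euclid_proj_dotp_le0 _ _ y _ Cc Pp (Pp x).1.
have h3 : dotp (p x - p y) (p x - p y) <= dotp (x - y) (p x - p y).
  by move: h1 h2; rewrite !dotpE (dotpC (p y) (p x)); lra.
have h4 := cauchy_schwarz (x - y) (p x - p y).
have [->|n0] := eqVneq (enorm (p x - p y)) 0; first exact: enorm_ge0.
have np : 0 < enorm (p x - p y) by rewrite lt_neqAle enorm_ge0 eq_sym n0.
by rewrite -(ler_pM2r np) -expr2 sqr_enorm; lra.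
Qed.

Lemma euclid_proj_id (C : set 'rV[R]_d) (p : 'rV[R]_d -> 'rV[R]_d) x :
  is_euclid_proj C p -> C x -> p x = x.
Proof.
move=> Pp Cx; have := (Pp x).2 _ Cx; rewrite subrr enorm0 => h.
apply/esym/eqP; rewrite -subr_eq0; apply/eqP/enorm_eq0/eqP.
by rewrite eq_le h enorm_ge0.
Qed.

Lemma clipK_id c u : enorm u <= c -> clipK c u = u.
Proof.
move=> uc; rewrite /clipK; have [u0|u0] := eqVneq (enorm u) 0.
  by rewrite (enorm_eq0 _ u0) scaler0.
have up : 0 < enorm u by rewrite lt_neqAle enorm_ge0 eq_sym u0.
by rewrite min_l ?scale1r// ler_pdivlMr// mul1r.
Qed.

Lemma clipK_gt c u : c < enorm u -> 0 <= c -> clipK c u = (c / enorm u) *: u.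
Proof.
move=> uc c0; rewrite /clipK min_r// ler_pdivrMr ?mul1r ?ltW//.
exact: le_lt_trans uc.
Qed.

Lemma enorm_clipK c u : 0 <= c -> enorm (clipK c u) <= c.
Proof.
move=> c0; have [uc|uc] := leP (enorm u) c; first by rewrite clipK_id.
have up : 0 < enorm u by exact: le_lt_trans uc.
rewrite clipK_gt// enormZ ger0_norm ?divr_ge0 ?enorm_ge0//.
by rewrite divfK// gt_eqF.
Qed.

(** Subtracting the clipped vector shortens [u] by [c], down to 0 at most; this is what drives the
    recursion of [Aseq]. *)
Lemma enorm_sub_clipK c u : 0 <= c ->
  enorm (u - clipK c u) = Num.max 0 (enorm u - c).
Proof.
move=> c0; have [uc|uc] := leP (enorm u) c.
  by rewrite clipK_id// subrr enorm0 max_l// subr_le0.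
have up : 0 < enorm u by exact: le_lt_trans uc.
rewrite clipK_gt// max_r ?subr_ge0 ?ltW//.
rewrite -[X in X - _]scale1r -scalerBl enormZ ger0_norm; last first.
  by rewrite subr_ge0 ler_pdivrMr// mul1r ltW.
by rewrite mulrBl mul1r divfK// gt_eqF.
Qed.

Lemma clipK_euclid_proj c : 0 <= c ->
  is_euclid_proj [set u : 'rV[R]_d | enorm u <= c] (clipK c).
Proof.
move=> c0 u; split => [/=|y /= yc]; first exact: enorm_clipK.
rewrite enorm_sub_clipK// ge_max enorm_ge0/= lerBlDr.
rewrite -[X in enorm X <= _](subrK y).
by apply: (le_trans (enormD _ _)); rewrite lerD2l.
Qed.

Lemma clipK_lipschitz c u v : 0 <= c ->
  enorm (clipK c u - clipK c v) <= enorm (u - v).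
Proof.
move=> c0; apply: (euclid_proj_lipschitz [set u : 'rV[R]_d | enorm u <= c]); last first.
  exact: clipK_euclid_proj.
move=> x y t /= xc yc /andP[t0 t1]; apply: (le_trans (enormD _ _)).
rewrite !enormZ !ger0_norm ?subr_ge0//.
have := ler_wpM2l t0 xc; have : 0 <= 1 - t by rewrite subr_ge0.
by move=> t1' h; have := ler_wpM2l t1' yc; lra.
Qed.

End Euclid.

Lemma convex_set_segment {R : realType} {d : nat} (C : set 'rV[R]_d) :
  convex_set C -> forall z1 z2 (t : R), C z1 -> C z2 -> 0 <= t <= 1 ->
  C (t *: z1 + (1 - t) *: z2).
Proof.
move=> Cc z1 z2 t C1 C2 /andP[t0 t1].
by have := Cc z1 z2 (Itv01 t0 t1) (mem_set C1) (mem_set C2); rewrite inE.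
Qed.

(** * The modulus [gfun] and its inverse *)

Section HolderModulus.
Context {R : realType}.
Variables (eta L lam : R).
Hypotheses (eta0 : 0 < eta) (L0 : 0 <= L) (lam0 : 0 < lam).
Local Notation g := (gfun eta L lam).
Local Notation h := (hfun eta L lam).

Lemma gfun0 : g 0 = 0.
Proof. by rewrite /gfun powR0 ?gt_eqF// mulr0 addr0. Qed.

Lemma gfun_le x y : 0 <= x -> x <= y -> g x <= g y.
Proof.
move=> x0 xy; apply: lerD => //; apply: ler_wpM2l; first by rewrite mulr_ge0// ltW.
by apply: ge0_ler_powR; rewrite ?nnegrE ?(ltW lam0)//; exact: le_trans xy.
Qed.

Lemma le_gfun x : 0 <= x -> x <= g x.
Proof. by move=> x0; rewrite /gfun lerDl !mulr_ge0 ?powR_ge0 ?(ltW eta0). Qed.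

Lemma gfun_small (e : R) : 0 < e -> exists2 del, 0 < del &
  forall x, 0 <= x -> x <= del -> g x <= e.
Proof.
(* The [+ 1] accounts for the linear term of [gfun] and keeps [c] positive when [L] is 0. *)
move=> e0; pose c := eta * L + 1.
have c0 : 0 < c by rewrite /c; have := mulr_ge0 (ltW eta0) L0; lra.
have ec : 0 < e / 2 / c by rewrite !divr_gt0.
exists (Num.min (e / 2) ((e / 2 / c) `^ lam^-1)).
  by rewrite lt_min divr_gt0// powR_gt0.
move=> x x0; rewrite le_min => /andP[x1 x2].
have p1 : x `^ lam <= e / 2 / c.
  have -> : e / 2 / c = ((e / 2 / c) `^ lam^-1) `^ lam.
    by rewrite -powRrM mulVf ?gt_eqF// powRr1// ltW.
  by apply: ge0_ler_powR; rewrite ?nnegrE ?powR_ge0 ?(ltW lam0).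
have : c * x `^ lam <= e / 2 by rewrite mulrC -ler_pdivlMr.
rewrite /gfun /c mulrDl mul1r; have := powR_ge0 x lam; lra.
Qed.

(** Intermediate value theorem on [0, y], since [g 0 = 0] and [y <= g y]. *)
Lemma gfun_surj (y : R) : 0 <= y -> exists2 x, 0 <= x & g x = y.
Proof.
rewrite le_eqVlt => /predU1P[<-|y0]; first by exists 0 => //; exact: gfun0.
have cpow (x : R) : 0 < x -> {for x, continuous (fun z : R => z `^ lam)}.
  move=> x0; apply/differentiable_continuous/derivable1_diffP.
  by apply: derivable_powR; rewrite in_itv/= andbT.
have gc : {within `[0, y], continuous g}.
  apply/continuous_within_itvP => //; split.
  - move=> x; rewrite in_itv/= => /andP[x0 _].
    apply: cvgD; first exact: cvg_id.
    by apply: cvgM; [exact: cvg_cst|exact: cpow].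
  (* [cpow] covers only positive points; at 0 the right limit of the power is used instead. *)
  - rewrite gfun0 -[X in _ --> X]addr0; apply: cvgD.
      by apply: cvg_at_right_filter; exact: cvg_id.
    rewrite -[X in _ --> X](mulr0 (eta * L)); apply: cvgM; first exact: cvg_cst.
    exact: powR_cvg0.
  - apply: cvg_at_left_filter; apply: cvgD; first exact: cvg_id.
    by apply: cvgM; [exact: cvg_cst|exact: cpow].
have gy := le_gfun y (ltW y0).
have [|x] := IVT (ltW y0) gc (v := y).
  by rewrite gfun0 ge_min (ltW y0)/= le_max gy orbT.
by rewrite in_itv/= => /andP[x0 _] xy; exists x.
Qed.

(** Surjectivity of [g] ensures that [xget] returns a true preimage and not its default. *)
Lemma hfun_spec (y : R) : 0 <= y -> 0 <= h y /\ g (h y) = y.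
Proof.
move=> /gfun_surj[x x0 gx].
suff : [set z | 0 <= z /\ g z = y] (h y) by [].
by apply: xgetPex; exists x.
Qed.

End HolderModulus.

(** * The coupled processes *)

Section RowMeasurability.
Context {R : realType} {d : nat}.
Local Notation V := (@rVm R d).

Lemma measurable_rV_coord (i : 'I_d) : measurable_fun [set: V] (fun v : V => v ord0 i).
Proof.
move=> _ A mA; rewrite setTI; apply: sub_sigma_algebra.
by exists i, A.
Qed.

Lemma measurable_fun_rV {d'} {T : measurableType d'} (f : T -> V) :
  (forall i, measurable_fun [set: T] (fun w => f w ord0 i)) ->
  measurable_fun [set: T] f.
Proof.
move=> mf; apply: (@measurability _ _ T V setT f (rV_gen d)) => // _ [_ [i [B [mB ->]]] <-].
by apply: mf.
Qed.

Definition enorm_continuous (h : 'rV[R]_d -> 'rV[R]_d) :=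
  forall x e, 0 < e -> exists2 del, 0 < del &
    forall y, enorm (x - y) <= del -> enorm (h x - h y) <= e.

(* An open set is the union of the rational cubes it contains. *)
Lemma measurable_enorm_continuous (h : 'rV[R]_d -> 'rV[R]_d) :
  enorm_continuous h -> measurable_fun [set: V] (h : V -> V).
Proof.
move=> ch; apply: measurable_fun_rV => i.
apply: (@measurability _ _ V (measurableTypeR R) setT (fun w => h w ord0 i)
  (@RGenOInfty.G R)); first exact: RGenOInfty.measurableE.
move=> _ [_ [b ->] <-]; rewrite setTI.
set U := _ @^-1` _.
pose cube (z : 'rV[rat]_d * rat) : set V :=
  \bigcap_(j in [set: 'I_d]) ((fun v : V => v ord0 j) @^-1`
     `](ratr (z.1 ord0 j) - ratr z.2), (ratr (z.1 ord0 j) + ratr z.2)[%classic).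
pose F z := if `[< cube z `<=` U >] then cube z else set0.
have -> : U = \bigcup_z F z.
  apply/seteqP; split => [x|x [z _]]; last by rewrite /F; case: asboolP => // zU; exact: zU.
  rewrite /U /= in_itv/= andbT => bx.
  have [|del del0 hdel] := ch x ((h x ord0 i - b) / 2); first by rewrite divr_gt0// subr_gt0.
  (* The centre will be within [r] of [x], and [y] within [r] of the centre, so the coordinates of
     [x - y] sum to at most 2rd in absolute value. Using [d.+1] covers dimension 0. *)
  have [r] : exists r, ratr r \in `]0, (del / (2 * d.+1%:R))[.
    by apply: rat_in_itvoo; rewrite divr_gt0// mulr_gt0.
  rewrite in_itv/= => /andP[r0 rdel].
  have qx j : exists q : rat, ratr q \in `](x ord0 j - ratr r), (x ord0 j + ratr r)[.
    by apply: rat_in_itvoo; rewrite ltrD2l; lra.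
  have [q hq] := choice qx.
  exists (\row_j q j, r) => //; rewrite /F; case: asboolP => [_|].
    by move=> j _ /=; have := hq j; rewrite mxE !in_itv/= => /andP[? ?]; apply/andP; split; lra.
  case=> y yc; rewrite /U /= in_itv/= andbT.
  have xy : enorm (x - y) <= del.
    apply: (le_trans (enorm_le_sum _)).
    apply: (@le_trans _ _ (\sum_(j < d) (2 * ratr r))).
      apply: ler_sum => j _; have := hq j; have := yc j I.
      rewrite /= !mxE !in_itv/= => /andP[? ?] /andP[? ?].
      by rewrite ler_norml; apply/andP; split; lra.
    rewrite sumr_const card_ord -mulr_natr.
    move: rdel; rewrite ltr_pdivlMr ?mulr_gt0// -natr1 => rdel.
    have : (0 : R) <= d%:R by [].
    nra.
  have := hdel _ xy; have := normr_coord_le (h x - h y) i.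
  rewrite !mxE => h1 h2; have := le_trans (ler_norm _) (le_trans h1 h2).
  by lra.
apply: countable_bigcupT_measurable => // z; rewrite /F; case: asboolP => // _.
apply: fin_bigcap_measurable => // j _.
by rewrite -[_ @^-1` _]setTI; exact: measurable_rV_coord.
Qed.

Lemma measurable_rV_add {d'} {T : measurableType d'} (f g : T -> V) :
  measurable_fun [set: T] f -> measurable_fun [set: T] g ->
  measurable_fun [set: T] (fun w => (f w + g w)%R : V).
Proof.
move=> mf mg; apply: measurable_fun_rV => i.
under eq_fun do rewrite mxE.
by apply: measurable_funD; exact: (measurableT_comp (measurable_rV_coord i)).
Qed.

Lemma measurable_rV_sub {d'} {T : measurableType d'} (f g : T -> V) :
  measurable_fun [set: T] f -> measurable_fun [set: T] g ->
  measurable_fun [set: T] (fun w => (f w - g w)%R : V).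
Proof.
move=> mf mg; apply: measurable_fun_rV => i.
under eq_fun do rewrite !mxE.
by apply: measurable_funB; exact: (measurableT_comp (measurable_rV_coord i)).
Qed.

Lemma enorm_lipschitz_continuous (h : 'rV[R]_d -> 'rV[R]_d) :
  (forall x y, enorm (h x - h y) <= enorm (x - y)) -> enorm_continuous h.
Proof. by move=> hl x e e0; exists e => // y /(le_trans (hl _ _)). Qed.

Lemma enorm_sum {I : Type} (s : seq I) (F : I -> 'rV[R]_d) :
  enorm (\sum_(i <- s) F i) <= \sum_(i <- s) enorm (F i).
Proof.
elim/big_rec2: _ => [|i u v _ h]; first by rewrite enorm0.
by apply: (le_trans (enormD _ _)); rewrite lerD2l.
Qed.

Lemma enorm_average_le {n : nat} (F : 'I_n -> 'rV[R]_d) (c : R) : 0 <= c ->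
  (forall i, enorm (F i) <= c) -> enorm (n%:R^-1 *: \sum_(i < n) F i) <= c.
Proof.
move=> c0 Fc; rewrite enormZ ger0_norm ?invr_ge0//.
have [->|n0] := eqVneq (n%:R : R) 0; first by rewrite invr0 mul0r.
have n1 : 0 < n%:R :> R by rewrite lt0r n0 ler0n.
rewrite mulrC ler_pdivrMr//.
apply: (le_trans (enorm_sum _ _)).
by apply: (le_trans (ler_sum _ (fun i _ => Fc i))); rewrite sumr_const card_ord mulr_natr.
Qed.

End RowMeasurability.

(** * The coupling and its pathwise distance bounds *)

Section Dynamics.
Context {R : realType} {d n : nat}.
Variables (Kset : set 'rV[R]_d) (PK : 'rV[R]_d -> 'rV[R]_d) (D L lam eta K : R).
Variables (W0 : 'rV[R]_d) (T tau : nat) (a : nat -> R).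
Variables (grads grads' : 'I_n -> 'rV[R]_d -> 'rV[R]_d) (i0 : 'I_n).
Hypothesis Kconv : forall z1 z2 t, Kset z1 -> Kset z2 -> 0 <= t <= 1 ->
  Kset (t *: z1 + (1 - t) *: z2).
Hypothesis KD : forall x y, Kset x -> Kset y -> enorm (x - y) <= D.
Hypothesis PKP : is_euclid_proj Kset PK.
Hypotheses (L0 : 0 <= L) (lam0 : 0 < lam) (eta0 : 0 < eta) (K0 : 0 < K).
Hypothesis W0K : Kset W0.
Hypothesis gradsH : forall i, holder_on Kset L lam (grads i).
Hypothesis gradsH' : forall i, holder_on Kset L lam (grads' i).
Hypothesis gradsE : forall j, j != i0 -> grads j = grads' j.
Hypothesis tauT : (tau < T)%N.
Hypothesis a0 : forall t, (tau <= t < T)%N -> 0 <= a t.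
Hypothesis feasible : Dseq eta L lam K D n tau <= Aseq eta L lam a T tau.

Definition gd_map (gr : 'I_n -> 'rV[R]_d -> 'rV[R]_d) (w : 'rV[R]_d) : 'rV[R]_d :=
  w - eta *: (n%:R^-1 *: \sum_(i < n) clipK K (gr i w)).

Local Notation phi := (gd_map grads).
Local Notation phi' := (gd_map grads').
Local Notation W' := (nsgd_iter PK eta K grads' W0).

Lemma gd_map_sub (gr1 gr2 : 'I_n -> 'rV[R]_d -> 'rV[R]_d) (w w' : 'rV[R]_d) :
  gd_map gr1 w - gd_map gr2 w' = (w - w') -
    eta *: (n%:R^-1 *: \sum_(i < n) (clipK K (gr1 i w) - clipK K (gr2 i w'))).
Proof.
rewrite /gd_map sumrB; set s1 := \sum_i _; set s2 := \sum_i _.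
by apply/rowP => i; rewrite !mxE; ring.
Qed.

Lemma gd_map_sub_le (gr1 gr2 : 'I_n -> 'rV[R]_d -> 'rV[R]_d) (w w' : 'rV[R]_d) (c : R) :
  0 <= c -> (forall i, enorm (clipK K (gr1 i w) - clipK K (gr2 i w')) <= c) ->
  enorm (gd_map gr1 w - gd_map gr2 w') <= enorm (w - w') + eta * c.
Proof.
move=> c0 hc; rewrite gd_map_sub; apply: (le_trans (enormD _ _)).
rewrite lerD2l enormN enormZ gtr0_norm// ler_pM2l//.
exact: enorm_average_le.
Qed.

(** Clipping is nonexpansive, so clipped gradients inherit the Hölder bound. *)
Lemma gd_map_holder (gr : 'I_n -> 'rV[R]_d -> 'rV[R]_d) (w w' : 'rV[R]_d) :
  (forall i, holder_on Kset L lam (gr i)) -> Kset w -> Kset w' ->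
  enorm (gd_map gr w - gd_map gr w') <= gfun eta L lam (enorm (w - w')).
Proof.
move=> grH Kw Kw'; rewrite /gfun -mulrA; apply: gd_map_sub_le.
  by rewrite mulr_ge0// powR_ge0.
by move=> i; apply: (le_trans (clipK_lipschitz _ _ _ (ltW K0))); exact: grH.
Qed.

Lemma gd_map_dist (w w' : 'rV[R]_d) :
  enorm (phi w - phi' w') <= enorm (w - w') + 2 * eta * K.
Proof.
rewrite (_ : 2 * eta * K = eta * (K + K)); last by ring.
apply: gd_map_sub_le; first by rewrite addr_ge0// ltW.
move=> i; apply: (le_trans (enormD _ _)); rewrite enormN.
by apply: lerD; apply: enorm_clipK; exact: ltW.
Qed.

(** Only the summand [i0] survives, a difference of two vectors of norm at most [K]. *)
Lemma gd_map_adjacent (w : 'rV[R]_d) : enorm (phi w - phi' w) <= 2 * eta * K / n%:R.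
Proof.
rewrite gd_map_sub subrr sub0r enormN (bigD1 i0)//= big1 ?addr0; last first.
  by move=> j ji; rewrite gradsE// subrr.
rewrite !enormZ gtr0_norm// ger0_norm ?invr_ge0//.
rewrite (_ : 2 * eta * K / n%:R = eta * (n%:R^-1 * (K + K))); last by ring.
rewrite ler_pM2l// ler_wpM2l ?invr_ge0//.
apply: (le_trans (enormD _ _)); rewrite enormN.
by apply: lerD; apply: enorm_clipK; exact: ltW.
Qed.

(* The shift applied to the noise at time t: beyond tau it cancels the
   difference of the two gradient maps at the second process and moves the
   first process towards it by a distance at most a t. *)
Definition drift_at (t : nat) (u w : 'rV[R]_d) : 'rV[R]_d :=
  if (t < tau)%N then 0 else phi w - phi' w + clipK (a t) (phi u - phi w).

(** The process U of the overview; [W' y] is Y, and [drift y] is the shift v. *)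
Fixpoint coupled (y : nat -> 'rV[R]_d) (t : nat) : 'rV[R]_d :=
  match t with
  | 0 => W0
  | s.+1 => PK (phi (coupled y s) + y s - drift_at s (coupled y s) (W' y s))
  end.

Definition drift (y : nat -> 'rV[R]_d) (t : nat) : 'rV[R]_d :=
  drift_at t (coupled y t) (W' y t).

Lemma nsgd_iter_in (gr : 'I_n -> 'rV[R]_d -> 'rV[R]_d) y t :
  Kset (nsgd_iter PK eta K gr W0 y t).
Proof. by case: t => //= t; exact: (PKP _).1. Qed.

Lemma coupled_in y t : Kset (coupled y t).
Proof. by case: t => //= t; exact: (PKP _).1. Qed.

(** Before [tau] both processes receive the same noise, which cancels. The three terms of the
    minimum come from the triangle inequality through [phi w], from clipping alone, and from the
    diameter. *)
Lemma coupled_dist_early y t : (t <= tau)%N ->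
  enorm (coupled y t - W' y t) <= Dseq eta L lam K D n t.
Proof.
elim: t => [|t IH] tt; first by rewrite /= subrr enorm0.
have {IH}IH := IH (ltnW tt).
rewrite /= !le_min KD ?andbT; [|exact: (PKP _).1|exact: (PKP _).1].
set u := coupled y t in IH *; set w := W' y t in IH *.
rewrite /nsgd_step -/(gd_map grads' _) /drift_at tt subr0.
have lip := euclid_proj_lipschitz _ _ (phi u + y t) (phi' w + y t) Kconv PKP.
have e1 : enorm (phi u + y t - (phi' w + y t)) = enorm (phi u - phi' w).
  by congr enorm; rewrite opprD addrACA subrr addr0.
rewrite e1 in lip; apply/andP; split; apply: (le_trans lip); last first.
  by apply: (le_trans (gd_map_dist _ _)); rewrite lerD2r.
have -> : phi u - phi' w = (phi u - phi w) + (phi w - phi' w) by rewrite addrA subrK.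
apply: (le_trans (enormD _ _)); apply: lerD; last exact: gd_map_adjacent.
apply: (le_trans (gd_map_holder _ _ _ gradsH _ _)).
- exact: coupled_in.
- exact: nsgd_iter_in.
- by apply: gfun_le => //; exact: enorm_ge0.
Qed.

(** [hfun_spec] needs a nonnegative argument; [k <= T - tau] keeps the indices of [a] at [tau] or
    later, where [a] is nonnegative. *)
Lemma Arec_ge0 k : (k <= T - tau)%N -> 0 <= Arec eta L lam a T k.
Proof.
elim: k => //= k IH kT; apply: (hfun_spec _ _ _ _ _ _ _ _).1 => //.
rewrite addr_ge0 ?IH ?(ltnW kT)// a0//.
by apply/andP; split; lia.
Qed.

(** The backward recursion read forwards: applying [gfun] undoes [hfun]. *)
Lemma Aseq_step t : (tau <= t < T)%N ->
  [/\ 0 <= Aseq eta L lam a T t, 0 <= Aseq eta L lam a T t.+1 &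
     gfun eta L lam (Aseq eta L lam a T t) = Aseq eta L lam a T t.+1 + a t].
Proof.
move=> tT; have A1 : 0 <= Aseq eta L lam a T t.+1 by apply: Arec_ge0; lia.
have tE : (T - t = (T - t.+1).+1)%N by lia.
have tE' : (T - (T - t.+1).+1 = t)%N by lia.
rewrite {1 3}/Aseq tE /= tE' -/(Aseq eta L lam a T t.+1).
by have [] := hfun_spec eta L lam eta0 L0 lam0 (Aseq eta L lam a T t.+1 + a t)
  (addr_ge0 A1 (a0 _ tT)).
Qed.

(** The drift cancels phi(w) - phi'(w) and leaves [phi u - phi w] minus its clip. Its length was at
    most g(A_t) = A_{t+1} + a_t, and clipping removes a_t. *)
Lemma coupled_dist_late y t : (tau <= t <= T)%N ->
  enorm (coupled y t - W' y t) <= Aseq eta L lam a T t.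
Proof.
elim: t => [|t IH] tT.
  (* Here [Dseq] vanishes at 0, so feasibility says that A_0 is nonnegative. *)
  have tau0 : tau = 0%N by lia.
  by rewrite /= subrr enorm0; move: feasible; rewrite tau0.
have [tt|tt] := leqP tau t; last first.
  have -> : t.+1 = tau by lia.
  by apply: (le_trans _ feasible); exact: coupled_dist_early.
have tT' : (tau <= t < T)%N by lia.
have [At At1 gA] := Aseq_step _ tT'.
have {IH}IH := IH ltac:(lia).
rewrite /=.
set u := coupled y t in IH *; set w := W' y t in IH *.
rewrite /nsgd_step -/(gd_map grads' _) /drift_at ltnNge tt /=.
apply: (le_trans (euclid_proj_lipschitz _ _ _ _ Kconv PKP)).
have -> : phi u + y t - (phi w - phi' w + clipK (a t) (phi u - phi w)) -
    (phi' w + y t) = (phi u - phi w) - clipK (a t) (phi u - phi w).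
  set c := clipK _ _.
  by apply/rowP => i; rewrite !mxE; ring.
rewrite enorm_sub_clipK; last exact: a0.
rewrite ge_max At1/= lerBlDr -gA.
apply: (le_trans (gd_map_holder _ _ _ gradsH _ _)).
- exact: coupled_in.
- exact: nsgd_iter_in.
- by apply: gfun_le => //; exact: enorm_ge0.
Qed.

Lemma coupled_final y : coupled y T = W' y T.
Proof.
have := coupled_dist_late y T; rewrite leqnn (ltnW tauT) => /(_ isT).
rewrite /Aseq subnn /= => h; apply/eqP; rewrite -subr_eq0; apply/eqP/enorm_eq0/eqP.
by rewrite eq_le h enorm_ge0.
Qed.

Lemma drift_early y t : (t < tau)%N -> drift y t = 0.
Proof. by rewrite /drift /drift_at => ->. Qed.

Lemma enorm_drift_le y t : (tau <= t < T)%N ->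
  enorm (drift y t) <= 2 * eta * K / n%:R + a t.
Proof.
move=> tT; rewrite /drift /drift_at ltnNge; case/andP: (tT) => -> _ /=.
apply: (le_trans (enormD _ _)); apply: lerD; first exact: gd_map_adjacent.
by apply: enorm_clipK; exact: a0.
Qed.

Lemma nsgd_iter_ext (gr : 'I_n -> 'rV[R]_d -> 'rV[R]_d) y y' t :
  (forall s, (s < t)%N -> y s = y' s) ->
  nsgd_iter PK eta K gr W0 y t = nsgd_iter PK eta K gr W0 y' t.
Proof.
elim: t => //= t IH yy; rewrite yy// IH// => s st.
by apply: yy; exact: ltnW.
Qed.

Lemma coupled_ext y y' t : (forall s, (s < t)%N -> y s = y' s) ->
  coupled y t = coupled y' t.
Proof.
elim: t => [//|t IH yy].
have yy' s : (s < t)%N -> y s = y' s by move=> st; apply: yy; exact: ltnW.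
by rewrite /= (IH yy') (nsgd_iter_ext grads' y y' t yy') (yy t (ltnSn t)).
Qed.

(** The adaptedness required by Girsanov: the shift at time [t] uses only strictly earlier noise. *)
Lemma drift_ext y y' t : (forall s, (s < t)%N -> y s = y' s) ->
  drift y t = drift y' t.
Proof.
by move=> yy; rewrite /drift (coupled_ext y y' t yy) (nsgd_iter_ext grads' y y' t yy).
Qed.

(** U is the ordinary run on the first dataset once the shift is counted as part of the noise. *)
Lemma nsgd_iter_drifted y t :
  nsgd_iter PK eta K grads W0 (fun s => y s - drift y s) t = coupled y t.
Proof. by elim: t => //= t ->; rewrite /nsgd_step -/(gd_map grads _) addrA. Qed.

Lemma PK_continuous : enorm_continuous PK.
Proof.
by apply: enorm_lipschitz_continuous => x y; exact: (euclid_proj_lipschitz Kset).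
Qed.

(** The Hölder bound holds only on [Kset]; precomposing with [PK] gives a map continuous everywhere
    that agrees with [gd_map gr] on the iterates. *)
Lemma gd_map_PK_continuous (gr : 'I_n -> 'rV[R]_d -> 'rV[R]_d) :
  (forall i, holder_on Kset L lam (gr i)) -> enorm_continuous (gd_map gr \o PK).
Proof.
move=> grH x e e0.
have [del del0 hdel] := gfun_small eta L lam eta0 L0 lam0 e e0.
exists del => // y xy /=.
apply: (le_trans (gd_map_holder _ _ _ grH (PKP x).1 (PKP y).1)).
apply: hdel; first exact: enorm_ge0.
by apply: (le_trans _ xy); exact: (euclid_proj_lipschitz Kset).
Qed.

Section Measurability.
Context {d' : measure_display} {U : measurableType d'}.
Variable y : nat -> U -> @rVm R d.
Hypothesis my : forall t, measurable_fun [set: U] (y t).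

Lemma measurable_gd_map (gr : 'I_n -> 'rV[R]_d -> 'rV[R]_d) (f : U -> @rVm R d) :
  (forall i, holder_on Kset L lam (gr i)) -> (forall w, Kset (f w)) ->
  measurable_fun [set: U] f ->
  measurable_fun [set: U] (fun w => gd_map gr (f w) : @rVm R d).
Proof.
move=> grH fK mf.
have fE w : gd_map gr (f w) = (gd_map gr \o PK) (f w).
  by rewrite /= (euclid_proj_id Kset PK (f w) PKP (fK w)).
under eq_fun do rewrite fE.
apply: (measurableT_comp _ mf).
by apply: measurable_enorm_continuous; exact: gd_map_PK_continuous.
Qed.

Lemma measurable_nsgd_iter (gr : 'I_n -> 'rV[R]_d -> 'rV[R]_d) t :
  (forall i, holder_on Kset L lam (gr i)) ->
  measurable_fun [set: U]
    (fun w => nsgd_iter PK eta K gr W0 (y ^~ w) t : @rVm R d).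
Proof.
move=> grH; elim: t => [|t IH]; first exact: measurable_cst.
apply: (measurableT_comp (measurable_enorm_continuous _ PK_continuous)).
apply: measurable_rV_add => //; apply: measurable_gd_map => // w.
exact: nsgd_iter_in.
Qed.

Lemma measurable_drift_at t (f g : U -> @rVm R d) :
  (forall w, Kset (f w)) -> (forall w, Kset (g w)) ->
  measurable_fun [set: U] f -> measurable_fun [set: U] g -> (t < T)%N ->
  measurable_fun [set: U] (fun w => drift_at t (f w) (g w) : @rVm R d).
Proof.
move=> fK gK mf mg tT; rewrite /drift_at; case: ltnP => tt; first exact: measurable_cst.
have mphi (h : U -> @rVm R d) : (forall w, Kset (h w)) -> measurable_fun [set: U] h ->
  measurable_fun [set: U] (fun w => gd_map grads (h w) : @rVm R d).
  by move=> hK mh; exact: measurable_gd_map.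
apply: measurable_rV_add.
  by apply: measurable_rV_sub; [exact: mphi|exact: measurable_gd_map].
have cc : enorm_continuous (clipK (a t) : 'rV[R]_d -> 'rV[R]_d).
  apply: enorm_lipschitz_continuous => u v; apply: clipK_lipschitz.
  by apply: a0; rewrite tt.
apply: (measurableT_comp (measurable_enorm_continuous _ cc)).
by apply: measurable_rV_sub; exact: mphi.
Qed.

Lemma measurable_coupled t : (t <= T)%N ->
  measurable_fun [set: U] (fun w => coupled (y ^~ w) t : @rVm R d).
Proof.
elim: t => [|t IH] tT; first exact: measurable_cst.
have {}IH := IH (ltnW tT).
apply: (measurableT_comp (measurable_enorm_continuous _ PK_continuous)).
apply: measurable_rV_sub.
  apply: measurable_rV_add => //; apply: measurable_gd_map => // w.
  exact: coupled_in.
apply: measurable_drift_at => //.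
- by move=> w; exact: coupled_in.
- by move=> w; exact: nsgd_iter_in.
- exact: measurable_nsgd_iter.
Qed.

Lemma measurable_drift t : (t < T)%N ->
  measurable_fun [set: U] (fun w => drift (y ^~ w) t : @rVm R d).
Proof.
move=> tT; apply: measurable_drift_at => //.
- by move=> w; exact: coupled_in.
- by move=> w; exact: nsgd_iter_in.
- by apply: measurable_coupled; exact: ltnW.
- exact: measurable_nsgd_iter.
Qed.

End Measurability.

End Dynamics.

(** * The divergence bound *)

(** For 0 < b < 1 the gap is the square of (1 - b) s - b r over b (1 - b). At the endpoints the
    bound is +oo unless the corresponding numerator is 0. *)
Lemma sqr_add_le_ediv {R : realType} (s r b : R) : 0 <= b <= 1 ->
  (((s + r) ^+ 2)%:E <= ediv (s ^+ 2) b + ediv (r ^+ 2) (1 - b))%E.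
Proof.
move=> /andP[b0 b1]; rewrite /ediv !sqrf_eq0.
have [bE|bn0] := eqVneq b 0.
  rewrite bE subr0 (negbTE (oner_neq0 R)) divr1.
  have [->|_] := eqVneq s 0; first by rewrite add0r add0e.
  by rewrite addye// leey.
have [bE|bn1] := eqVneq (1 - b) 0.
  have -> : b = 1 by move/eqP: bE; rewrite subr_eq0 => /eqP.
  rewrite divr1; have [->|_] := eqVneq r 0; first by rewrite addr0 adde0.
  by rewrite addey// leey.
rewrite -EFinD lee_fin -subr_ge0.
have -> : s ^+ 2 / b + r ^+ 2 / (1 - b) - (s + r) ^+ 2 =
    ((1 - b) * s - b * r) ^+ 2 / (b * (1 - b)).
  by field; rewrite ?bn0 ?bn1.
by rewrite divr_ge0 ?sqr_ge0// mulr_ge0// subr_ge0.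
Qed.

(** * Flattening the noise into finitely many real coordinates *)

Section NoiseSequence.
Context {R : realType} {T d : nat}.
Local Notation I := ('I_T * 'I_d)%type.

(** Rows from time [T] on are set to 0, because [nsgd_iter] takes an infinite sequence. *)
Definition noise_seq (x : I -> R) (t : nat) : 'rV[R]_d :=
  \row_i oapp (fun s : 'I_T => x (s, i)) 0 (insub t).

Lemma noise_seqE (x : I -> R) (t : 'I_T) (i : 'I_d) : noise_seq x t ord0 i = x (t, i).
Proof. by rewrite mxE valK. Qed.

Lemma measurable_noise_seq t :
  measurable_fun [set: boxT R I] (fun x => noise_seq x t : @rVm R d).
Proof.
apply: measurable_fun_rV => i.
have -> : (fun x : boxT R I => noise_seq x t ord0 i) =
    (fun x => oapp (fun s : 'I_T => x (s, i)) 0 (insub t)).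
  by apply/funext => x; rewrite mxE.
by case: insubP => [s _ _|_] /=; [exact: (measurable_coord (s, i))|exact: measurable_cst].
Qed.

(** Orders by time first, so that everything before time [t] has smaller rank than any coordinate of
    time [t]. *)
Definition coord_rank (k : I) : nat := (k.1 * d + k.2)%N.

Lemma coord_rank_inj : injective coord_rank.
Proof.
move=> [t i] [t' i']; rewrite /coord_rank /= => h.
have d0 : (0 < d)%N by exact: leq_ltn_trans (ltn_ord i).
have := congr1 (divn^~ d) h; rewrite /= !divnMDl// !divn_small// !addn0 => tt.
have := congr1 (modn^~ d) h; rewrite /= !modnMDl !modn_small// => ii.
by congr pair; apply: val_inj.
Qed.

Lemma noise_seq_trunc (x : I -> R) (k : I) s : (s < k.1)%N ->
  noise_seq (trunc coord_rank (coord_rank k) x) s = noise_seq x s.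
Proof.
move=> sk; apply/rowP => i; rewrite !mxE; case: insubP => //= s' _ s's.
rewrite /trunc ifT// /coord_rank /= s's.
have : (s.+1 * d <= k.1 * d)%N by rewrite leq_mul2r sk orbT.
have := ltn_ord i; rewrite mulSn; lia.
Qed.

End NoiseSequence.

(** The minimum is rendered as a bound for every feasible choice of [tau], [beta] and [a]. *)
Theorem mainTheorem2
  (R : realType) (d n T : nat) (X : Type)
  (loss : X -> 'rV[R]_d -> R) (grad : X -> 'rV[R]_d -> 'rV[R]_d)
  (Kset : set 'rV[R]_d) (PK : 'rV[R]_d -> 'rV[R]_d) (D L lam eta sigma K : R)
  (dO : measure_display) (O : measurableType dO) (P : probability O R)
  (G : nat -> O -> 'rV[R]_d) (W0 : 'rV[R]_d) (Ds Ds' : 'I_n -> X)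
  (alpha : R) (tau : nat) (beta a : nat -> R) :
  (* the constraint set *)
  (exists w, Kset w) -> closed Kset -> convex_set Kset -> has_diameter Kset D ->
  is_euclid_proj Kset PK ->
  (* losses, gradients, Hölder continuity *)
  (forall z, is_gradient_on Kset (loss z) (grad z)) ->
  0 <= L -> 0 < lam -> lam <= 1 ->
  (forall z, holder_on Kset L lam (grad z)) ->
  (* algorithm parameters *)
  0 < eta -> 0 < sigma -> 0 < K -> (1 <= T)%N -> Kset W0 ->
  iid_gaussian_noise P d sigma G ->
  adjacent_datasets Ds Ds' ->
  1 < alpha ->
  (* feasible (tau, beta, a) *)
  (tau < T)%N ->
  (forall t, (tau <= t < T)%N -> 0 <= beta t <= 1 /\ 0 <= a t) ->
  Dseq eta L lam K D n tau <= Aseq eta L lam a T tau ->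
  (renyi_div P alpha
     (fun w => nsgd_iter PK eta K (fun i => grad (Ds i)) W0 (fun t => G t w) T : @rVm R d)
     (fun w => nsgd_iter PK eta K (fun i => grad (Ds' i)) W0 (fun t => G t w) T : @rVm R d)
   <= eps_bound alpha sigma eta K n T tau beta a)%E.
Proof.
move=> _ _ Kconvex [KD _] PKP _ L0 lam0 _ gradH eta0 sigma0 K0 _ W0K [mG Glaw Gindep]
  [i0 [_ DsE]] alpha1 tauT feas AD.
have Kconv := convex_set_segment Kset Kconvex.
pose grads i := grad (Ds i); pose grads' i := grad (Ds' i).
have gradsH i : holder_on Kset L lam (grads i) by exact: gradH.
have gradsH' i : holder_on Kset L lam (grads' i) by exact: gradH.
have gradsE j : j != i0 -> grads j = grads' j by move=> ji; rewrite /grads DsE.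
have a0 t : (tau <= t < T)%N -> 0 <= a t by move=> /feas[].
have s0 : sigma != 0 by rewrite gt_eqF.
pose xi (k : 'I_T * 'I_d) (w : O) : R := G k.1 w ord0 k.2.
have mxi k : measurable_fun [set: O] (xi k) by exact: mG.
have xi_law k B : measurable B -> P (xi k @^-1` B) = normal_prob 0 sigma B.
  exact: Glaw.
have xi_indep : mutually_independent P xi by exact: Gindep.
pose Xi (w : O) : boxT R ('I_T * 'I_d)%type := fun k => xi k w.
have mXi : measurable_fun [set: O] Xi by exact: measurable_noise.
have XiE w t : (t < T)%N -> noise_seq (Xi w) t = G t w.
  by move=> tT; apply/rowP => i; rewrite (noise_seqE _ (Ordinal tT)).
pose dr := drift PK eta K W0 tau a grads grads'.
pose v (k : 'I_T * 'I_d) (x : boxT R ('I_T * 'I_d)%type) : R :=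
  dr (noise_seq x) k.1 ord0 k.2.
have mdr (t : 'I_T) : measurable_fun [set: boxT R ('I_T * 'I_d)%type]
    (fun x => dr (noise_seq x) t : @rVm R d).
  exact: (measurable_drift Kset PK L lam eta K W0 T tau a grads grads' Kconv PKP
    L0 lam0 eta0 K0 W0K gradsH gradsH' a0
    (fun t (x : boxT R ('I_T * 'I_d)%type) => noise_seq x t) measurable_noise_seq t (ltn_ord t)).
have mv k : measurable_fun [set: boxT R ('I_T * 'I_d)%type] (v k).
  exact: (measurableT_comp (measurable_rV_coord k.2) (mdr k.1)).
have v_adapted k x : v k x = v k (trunc coord_rank (coord_rank k) x).
  have E : dr (noise_seq (trunc coord_rank (coord_rank k) x)) k.1 =
      dr (noise_seq x) k.1.
    exact: (drift_ext PK eta K W0 tau a grads grads' _ _ k.1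
      (fun s sk => noise_seq_trunc x k s sk)).
  by rewrite /v [in RHS]E.
pose M w := shift_density sigma v (Xi w).
pose V := \sum_(tau <= t < T) (2 * eta * K / n%:R + a t) ^+ 2.
have vV x : \sum_k v k x ^+ 2 <= V.
  pose nd t := enorm (dr (noise_seq x) t) ^+ 2.
  have -> : \sum_k v k x ^+ 2 = \sum_(0 <= t < T) nd t.
    rewrite big_mkord (eq_bigr (fun t : 'I_T => \sum_(i < d) v (t, i) x ^+ 2)).
      by rewrite pair_bigA; apply: eq_bigr => -[].
    by move=> t _; rewrite /nd sqr_enorm; apply: eq_bigr => i _; rewrite expr2.
  (* The drift vanishes before [tau], so only the times from [tau] on contribute. *)
  rewrite (@big_cat_nat _ _ _ tau) ?(ltnW tauT)//= big_nat big1 ?add0r; last first.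
    by move=> t tt; rewrite /nd /dr drift_early// enorm0 expr0n.
  rewrite big_nat [leRHS]big_nat; apply: ler_sum => t tT.
  have h : enorm (dr (noise_seq x) t) <= 2 * eta * K / n%:R + a t.
    exact: (enorm_drift_le PK eta K W0 T tau a grads grads' i0 eta0 K0 gradsE a0 _ t tT).
  by rewrite ler_sqr ?nnegrE ?enorm_ge0// (le_trans (enorm_ge0 _) h).
pose XT w : @rVm R d := nsgd_iter PK eta K grads W0 (fun t => G t w) T.
pose YT w : @rVm R d := nsgd_iter PK eta K grads' W0 (fun t => G t w) T.
pose F (gr : 'I_n -> 'rV[R]_d -> 'rV[R]_d) (x : boxT R ('I_T * 'I_d)%type) : @rVm R d :=
  nsgd_iter PK eta K gr W0 (noise_seq x) T.
have mF gr : (forall i, holder_on Kset L lam (gr i)) ->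
    measurable_fun [set: boxT R ('I_T * 'I_d)%type] (F gr).
  move=> grH.
  exact: (measurable_nsgd_iter Kset PK L lam eta K W0 Kconv PKP L0 lam0
    eta0 K0 W0K
    (fun t (x : boxT R ('I_T * 'I_d)%type) => noise_seq x t) measurable_noise_seq gr T grH).
have FE gr w : F gr (Xi w) = nsgd_iter PK eta K gr W0 (fun t => G t w) T.
  by apply: nsgd_iter_ext => s sT; rewrite XiE.
have mXT : measurable_fun [set: O] XT.
  rewrite (_ : XT = F grads \o Xi); last by apply/funext => w; rewrite /= FE.
  exact: (measurableT_comp (mF _ gradsH) mXi).
have mYT : measurable_fun [set: O] YT.
  rewrite (_ : YT = F grads' \o Xi); last by apply/funext => w; rewrite /= FE.
  exact: (measurableT_comp (mF _ gradsH') mXi).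
(* The coupling enters here: the first run on shifted noise is U, which has met Y at time [T]. *)
have drE w : F grads (drifted v (Xi w)) = YT w.
  transitivity (nsgd_iter PK eta K grads W0
      (fun s => noise_seq (Xi w) s - dr (noise_seq (Xi w)) s) T).
    apply: nsgd_iter_ext => s sT; apply/rowP => i.
    by rewrite (noise_seqE _ (Ordinal sT)) !mxE insubT/=.
  rewrite nsgd_iter_drifted (coupled_final Kset PK D L lam eta K W0 T tau a
    grads grads' i0 Kconv KD PKP L0 lam0 eta0 K0 W0K gradsH gradsE tauT a0 AD).
  exact: FE.
(* Girsanov for the event that the first run ends in [A]; by [drE] its shifted version is the event
   that Y ends in [A]. *)
have MXY (A : set (@rVm R d)) : measurable A ->
    (P (XT @^-1` A) = \int[P]_(w in YT @^-1` A) (M w)%:E)%E.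
  move=> mA.
  have mFA : measurable (F grads @^-1` A) by rewrite -[_ @^-1` _]setTI; exact: mF.
  have := girsanov P sigma xi coord_rank s0 mxi xi_law xi_indep coord_rank_inj v mv
    v_adapted _ mFA.
  have -> : [set w | (F grads @^-1` A) (drifted v (fun k => xi k w))] = YT @^-1` A.
    by apply/seteqP; split => w /=; rewrite drE.
  have -> : [set w | (F grads @^-1` A) (fun k => xi k w)] = XT @^-1` A.
    by apply/seteqP; split => w /=; rewrite [F grads _]FE.
  by move=> <-.
have mM : measurable_fun [set: O] M.
  exact: (measurableT_comp (measurable_shift_density sigma v mv) mXi).
have Mmom := shift_density_moment P sigma xi coord_rank s0 mxi xi_law xi_indep
  coord_rank_inj v alpha V alpha1 mv v_adapted vV.
apply: (le_trans (renyi_div_coupling_le P d XT YT M mXT mYT mM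
  (fun w => shift_density_ge0 _ _ _) MXY alpha _ alpha1 Mmom)).
(* The prefactor of the divergence cancels the [alpha - 1] of the moment bound. *)
have -> : (alpha - 1)^-1 * (alpha * (alpha - 1) / (2 * sigma ^+ 2) * V) =
    alpha / (2 * sigma ^+ 2) * V.
  by field; rewrite s0 subr_eq0 gt_eqF.
rewrite EFinM /eps_bound lee_pmul2l//; last first.
  by rewrite lte_fin divr_gt0 ?mulr_gt0 ?exprn_gt0//; lra.
rewrite /V -sumEFin big_nat [leRHS]big_nat.
apply: lee_sum => t tT; apply: sqr_add_le_ediv.
by have [] := feas t tT.
Qed.
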